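(* Let $\mathcal{E}$ be a countable directed graph without sinks, $S$ its graph inverse semigroup and $G$ its path groupoid. There are natural one-to-one correspondences between: (a) the class $\mathfrak{R}_{\mathcal{E}}$ of representations of $\mathcal{E}$; (b) the class $\mathfrak{R}_{S}$ of representations of $S$ that vanish on $z$ and on elements of the form $v-\sum_{s(e)=v}(e,e)$ for all $v\in V_f$; (c) the class $\mathfrak{R}_{G}$ of representations of the locally compact groupoid $G$.
   Context: Graph conventions. $\mathcal{E}$ is a directed graph with countable vertex set $V$ and countable edge set $E$; $s(e),r(e)$ are the initial and terminal vertices of an edge $e$. No sinks: every vertex is the source of at least one edge. $V_f$ (resp. $V_\infty$) is the set of vertices emitting finitely (resp. infinitely) many edges. A finite path is $\alpha=e_1\cdots e_k$ with $r(e_i)=s(e_{i+1})$, length $l(\alpha)=k$, $s(\alpha)=s(e_1)$, $r(\alpha)=r(e_k)$; each vertex $v$ is a finite path of length $0$ with $s(v)=r(v)=v$, and $s(\mu)\mu=\mu=\mu r(\mu)$. $Y$ is the set of finite paths, $Z$ the set of infinite paths $z_1z_2\cdots$, and $Y_\infty=\{y\in Y: r(y)\in V_\infty\}$. Representations of the graph. A representation of $\mathcal{E}$ on a Hilbert space $\mathfrak{H}$ is a family $\{P_v\}_{v\in V}$ of mutually orthogonal projections and a family $\{S_e\}_{e\in E}$ of partial isometries such that the projections $S_eS_e^*$ are mutually orthogonal and: (i) $S_e^*S_e=P_{r(e)}$ for all $e\in E$; (ii) $P_v=\sum_{s(e)=v}S_eS_e^*$ for all $v\in V_f$; (iii) $P_{s(e)}S_eS_e^*=S_eS_e^*$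 for all $e\in E$. Graph inverse semigroup. $S$ consists of the pairs $(\alpha,\beta)$ of finite paths with $r(\alpha)=r(\beta)$ together with a zero element $z$, with involution $(\alpha,\beta)^*=(\beta,\alpha)$, $z^*=z$, and product $(\alpha,\alpha'\mu)(\alpha',\beta)=(\alpha,\beta\mu)$, $(\alpha,\alpha')(\alpha'\mu,\beta')=(\alpha\mu,\beta')$, all other products being $z$. A vertex $v$ is identified with $(v,v)$. A representation of $S$ is a $*$-homomorphism $\Pi:S\to B(\mathfrak{H})$ (multiplicative, $\Pi(s^* )=\Pi(s)^*$); it is extended linearly to finite linear combinations of elements of $S$. Path groupoid. $X=Y_\infty\cup Z$. $G$ is the set of triples $(\alpha\gamma,\,l(\alpha)-l(\beta),\,\beta\gamma)$ with $\alpha,\beta\in Y$, $\gamma\in X$, $r(\alpha)=r(\beta)=s(\gamma)$; multiplication $(x,m,y)(y,n,w)=(x,m+n,w)$, inverse $(x,m,y)^{-1}=(y,-m,x)$, unit space identified with $X$ via $x\leftrightarrow(x,0,x)$. For $\alpha,\beta\in Y$ with $r(\alpha)=r(\beta)$ let $A'_{\alpha,\beta}=\{(\alpha\gamma,l(\alpha)-l(\beta),\beta\gamma)\in G\}$. A basis for the topology of $G$ is given by the sets $A'_{\alpha,\beta}\setminus\bigcup_{i=1}^nA'_{\alpha\mu_i,\beta\mu_i}$ ($n\ge 0$, $\mu_i\in Y$ with $s(\mu_i)=r(\alpha)$). $G$ is an r-discrete (étale) locally compact Hausdorff groupoid with counting measures as left Haar system. Representations of $G$ are identified with the non-degenerate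 $I$-norm continuous $*$-representations of the convolution algebra $C_c(G)$ on Hilbert spaces, where $\|f\|_I=\max\{\sup_{u\in X}\sum_{r(g)=u}|f(g)|,\ \sup_{u\in X}\sum_{s(g)=u}|f(g)|\}$. All representations are assumed non-degenerate. *)

(* Defs.v *)
From HB Require Import structures.
From mathcomp Require Import all_boot all_order all_algebra.
From mathcomp Require Import all_classical all_reals all_analysis.
From mathcomp Require Import complex zify.

Set Implicit Arguments.
Unset Strict Implicit.
Unset Printing Implicit Defensive.

Import Order.TTheory GRing.Theory Num.Theory.
Import numFieldNormedType.Exports.

Local Open Scope classical_set_scope.
Local Open Scope ring_scope.

Record digraph := Digraph {
  vertex : countType;
  edge : countType;
  esrc : edge -> vertex;
  etgt : edge -> vertex }.

Section Paths.
Variable E : digraph.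
Implicit Types (v : vertex E) (e : edge E).

Definition out v : set (edge E) := [set e | esrc e = v].
Definition no_sinks := forall v, out v !=set0.
Definition Vfin : set (vertex E) := [set v | finite_set (out v)].
Definition Vinf : set (vertex E) := [set v | infinite_set (out v)].

Fixpoint walk v (p : seq (edge E)) : bool :=
  if p is e :: q then (esrc e == v) && walk (etgt e) q else true.

(* A finite path is a pair (initial vertex, list of edges), so that (v, [::])
   is the path of length 0 at v. *)
Definition finpath := {p : vertex E * seq (edge E) | walk p.1 p.2}.
HB.instance Definition _ := Countable.on finpath.
HB.instance Definition _ := SubType.on finpath.
Implicit Types (a b c d m : finpath).

Definition pedges a : seq (edge E) := (val a).2.
Definition plen a : nat := size (pedges a).
Definition psrc a : vertex E := (val a).1.
Definition ptgt a : vertex E := last (psrc a) (map (@etgt E) (pedges a)).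

Definition vpath v : finpath := exist _ (v, [::]) isT.

Lemma walk1 e : walk (esrc e) [:: e]. Proof. by rewrite /= eqxx. Qed.
Definition epath e : finpath := exist _ (esrc e, [:: e]) (walk1 e).

(* Concatenation; the value is meaningful only when ptgt a = psrc b (see
   pcatE), and is a otherwise. *)
Definition pcat a b : finpath := insubd a (psrc a, pedges a ++ pedges b).

Lemma walk_cat v p q :
  walk v (p ++ q) = walk v p && walk (last v (map (@etgt E) p)) q.
Proof. by elim: p v => //= e p IH v; rewrite IH andbA. Qed.

Lemma pcatE a b : ptgt a = psrc b ->
  val (pcat a b) = (psrc a, pedges a ++ pedges b).
Proof.
move=> ab; rewrite /pcat val_insubd /= walk_cat.
have -> : walk (psrc a) (pedges a) by exact: (valP a).
by move: (valP b); rewrite -/(psrc b) -ab /ptgt /pedges => ->.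
Qed.

Lemma psrc_cat a b : ptgt a = psrc b -> psrc (pcat a b) = psrc a.
Proof. by move=> ab; rewrite /psrc pcatE. Qed.

Lemma pedges_cat a b : ptgt a = psrc b ->
  pedges (pcat a b) = pedges a ++ pedges b.
Proof. by move=> ab; rewrite /pedges pcatE. Qed.

Lemma plen_cat a b : ptgt a = psrc b -> plen (pcat a b) = (plen a + plen b)%N.
Proof. by move=> ab; rewrite /plen pedges_cat// size_cat. Qed.

Lemma ptgt_cat a b : ptgt a = psrc b -> ptgt (pcat a b) = ptgt b.
Proof.
by move=> ab; rewrite /ptgt psrc_cat// pedges_cat// map_cat last_cat -ab.
Qed.

Lemma finpath_inj a b : psrc a = psrc b -> pedges a = pedges b -> a = b.
Proof.
move=> s p; apply: val_inj; move: s p; rewrite /psrc /pedges.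
by case: (val a) (val b) => [? ?] [? ?] /= -> ->.
Qed.

Definition ipath :=
  {z : nat -> edge E | `[< forall i, etgt (z i) = esrc (z i.+1) >]}.
Definition Yinf := {y : finpath | `[< Vinf (ptgt y) >]}.
HB.instance Definition _ := Choice.on ipath.
HB.instance Definition _ := SubType.on ipath.
HB.instance Definition _ := Choice.on Yinf.
HB.instance Definition _ := SubType.on Yinf.

(* The unit space X, disjoint union of the finite paths ending at an infinite
   emitter and of the infinite paths. *)
Definition bpath : choiceType := (Yinf + ipath)%type.
Implicit Types (x y : bpath).

Definition xsrc x : vertex E :=
  match x with inl y => psrc (val y) | inr z => esrc (val z 0%N) end.

Definition stream_cat a (z : nat -> edge E) (n : nat) : edge E :=
  if (n < plen a)%N then nth (z 0%N) (pedges a) n else z (n - plen a)%N.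

(* Concatenation of a finite path with an element of X; meaningful only when
   ptgt a = xsrc x (see xcat_fin and xcat_inf). *)
Definition xcat a x : bpath :=
  match x with
  | inl y => inl (insubd y (pcat a (val y)))
  | inr z => inr (insubd z (stream_cat a (val z)))
  end.

Lemma xcat_fin a (y : Yinf) : ptgt a = psrc (val y) ->
  exists2 y' : Yinf, xcat a (inl y) = inl y' & val y' = pcat a (val y).
Proof.
move=> ay; exists (insubd y (pcat a (val y))) => //.
rewrite val_insubd ifT//; apply/asboolP; rewrite ptgt_cat//.
by have /asboolP := valP y.
Qed.

Lemma stream_cat_walk a (z : nat -> edge E) : ptgt a = esrc (z 0%N) ->
  (forall i, etgt (z i) = esrc (z i.+1)) ->
  forall i, etgt (stream_cat a z i) = esrc (stream_cat a z i.+1).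
Proof.
rewrite /stream_cat /plen /ptgt.
have : walk (psrc a) (pedges a) by exact: (valP a).
elim: (pedges a) (psrc a) => [|e p IH] v /=.
  by move=> _ _ hz i; rewrite !subn0.
move=> /andP[_ wp] pz hz [|i] /=.
  case: p wp pz {IH} => [_ pz|e' p /= /andP[/eqP-> _] //].
  by rewrite /= subnn.
by have := IH _ wp pz hz i; rewrite !ltnS !subSS.
Qed.

Lemma xcat_inf a (z : ipath) : ptgt a = esrc (val z 0%N) ->
  exists2 z' : ipath, xcat a (inr z) = inr z' & val z' = stream_cat a (val z).
Proof.
move=> az; exists (insubd z (stream_cat a (val z))) => //.
rewrite val_insubd ifT//; apply/asboolP; apply: stream_cat_walk => //.
by have /asboolP := valP z.
Qed.


Definition is_prefix b c : bool :=
  (psrc b == psrc c) && prefix (pedges b) (pedges c).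

(* The path m such that c = b m; meaningful only when is_prefix b c. *)
Definition pquot b c : finpath := insubd b (ptgt b, drop (plen b) (pedges c)).

Lemma is_prefixP b c :
  reflect (exists2 m, ptgt b = psrc m & c = pcat b m) (is_prefix b c).
Proof.
apply: (iffP andP) => [[/eqP sbc /prefixP[q cq]]|[m bm ->]]; last first.
  by rewrite psrc_cat// eqxx pedges_cat// prefix_prefix.
have : walk (psrc c) (pedges c) by exact: (valP c).
rewrite cq -sbc walk_cat => /andP[_ wq].
pose m : finpath := exist _ (ptgt b, q) wq.
by exists m => //; apply: finpath_inj; rewrite ?psrc_cat// pedges_cat.
Qed.

Lemma pquot_cat b m : ptgt b = psrc m -> pquot b (pcat b m) = m.
Proof.
move=> bm; apply: val_inj; rewrite /pquot pedges_cat// drop_size_cat//.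
rewrite bm val_insubd ifT; first by case: m bm => -[].
exact: (valP m).
Qed.

Lemma pcat_injr b m m' : ptgt b = psrc m -> ptgt b = psrc m' ->
  pcat b m = pcat b m' -> m = m'.
Proof. by move=> h h' e; rewrite -(pquot_cat h) e pquot_cat. Qed.

Lemma pcatA a b c : ptgt a = psrc b -> ptgt b = psrc c ->
  pcat (pcat a b) c = pcat a (pcat b c).
Proof.
move=> ab bc; apply: finpath_inj; first by rewrite !psrc_cat// ptgt_cat.
by rewrite !pedges_cat ?psrc_cat ?ptgt_cat// catA.
Qed.

(* The graph inverse semigroup; None is the zero element. *)
Definition gis := option {p : finpath * finpath | ptgt p.1 == ptgt p.2}.

(* The element (a, b); meaningful only when ptgt a = ptgt b (see sppE). *)
Definition spp a b : gis := insub (a, b).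

Lemma sppE a b (ab : ptgt a == ptgt b) : spp a b = Some (exist _ (a, b) ab).
Proof.
rewrite /spp; case: insubP => [u _ e|]; last by rewrite ab.
by congr Some; apply: val_inj.
Qed.

Definition sstar (s : gis) : gis :=
  if s is Some p then spp (val p).2 (val p).1 else None.

Definition smul (s t : gis) : gis :=
  match s, t with
  | Some p, Some q =>
    let: (a, b) := val p in let: (c, d) := val q in
    if is_prefix c b then spp a (pcat d (pquot c b))
    else if is_prefix b c then spp (pcat a (pquot b c)) d
    else None
  | _, _ => None
  end.

Lemma smul_catl a a' b m : ptgt a' = psrc m -> ptgt a = ptgt m ->
  ptgt a' = ptgt b ->
  smul (spp a (pcat a' m)) (spp a' b) = spp a (pcat b m).
Proof.
move=> am am' ab; have h : ptgt a == ptgt (pcat a' m) by rewrite ptgt_cat// am'.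
rewrite (sppE h) (sppE (introT eqP ab)) /= ifT ?pquot_cat//.
by apply/is_prefixP; exists m.
Qed.

Lemma smul_catr a a' b' m : ptgt a' = psrc m -> ptgt m = ptgt b' ->
  ptgt a = ptgt a' ->
  smul (spp a a') (spp (pcat a' m) b') = spp (pcat a m) b'.
Proof.
move=> am mb aa; have h : ptgt (pcat a' m) == ptgt b' by rewrite ptgt_cat// mb.
rewrite (sppE h) (sppE (introT eqP aa)) /= pquot_cat//.
have -> : is_prefix a' (pcat a' m) by apply/is_prefixP; exists m.
case: ifPn => // /is_prefixP[m' m'1 m'2].
have : pedges a' = pedges a' ++ (pedges m ++ pedges m').
  by rewrite catA -pedges_cat// -pedges_cat// -m'2.
move=> /(congr1 size); rewrite size_cat => /esym/eqP.
rewrite -[X in _ == X]addn0 eqn_add2l size_cat addn_eq0.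
move=> /andP[/nilP m0 /nilP m'0].
have pm : pcat a' m = a'.
  by apply: finpath_inj; rewrite ?psrc_cat// pedges_cat// m0 cats0.
have tm : ptgt m = psrc m by rewrite /ptgt m0.
have -> : pquot (pcat a' m) a' = m.
  by rewrite pm -{2}pm pquot_cat.
have -> : pcat b' m = b'.
  by apply: finpath_inj; rewrite ?psrc_cat -?mb// pedges_cat -?mb// m0 cats0.
suff -> : pcat a m = a by [].
have aa' : ptgt a = psrc m by rewrite aa.
by apply: finpath_inj; rewrite ?psrc_cat// pedges_cat// m0 cats0.
Qed.

Lemma smul_zero a b c d : ptgt a = ptgt b -> ptgt c = ptgt d ->
  (forall m, ptgt c = psrc m -> b <> pcat c m) ->
  (forall m, ptgt b = psrc m -> c <> pcat b m) ->
  smul (spp a b) (spp c d) = None.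
Proof.
move=> /eqP ab /eqP cd h1 h2; rewrite (sppE ab) (sppE cd) /=.
case: is_prefixP => [[m cm]|_]; first by move/h1; case.
by case: is_prefixP => // -[m bm] /h2; case.
Qed.

(* x seen as a sequence of edges, undefined past its end. *)
Definition xnth x (n : nat) : option (edge E) :=
  match x with inl y => onth (pedges (val y)) n | inr z => Some (val z n) end.

Lemma xext x y : xsrc x = xsrc y -> xnth x =1 xnth y -> x = y.
Proof.
have fin_inf (p : seq (edge E)) (z : nat -> edge E) :
    ~ (forall n, onth p n = Some (z n)).
  by move=> h; have := h (size p); rewrite onth_default.
case: x y => [x|x] [y|y] /= s h.
- by congr inl; apply: val_inj; apply: finpath_inj => //; apply: eq_from_onth.
- by have := fin_inf _ _ h.
- by have := fin_inf _ _ (fun n => esym (h n)).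
- by congr inr; apply: val_inj; apply/funext => n; have [] := h n.
Qed.

Lemma xsrc_cat a x : ptgt a = xsrc x -> xsrc (xcat a x) = psrc a.
Proof.
case: x => [y|z] h.
  by have [y' -> /= ->] := xcat_fin h; rewrite psrc_cat.
have [z' -> /= ->] := xcat_inf h; move: h; rewrite /stream_cat /plen /ptgt /=.
have : walk (psrc a) (pedges a) by exact: (valP a).
by case: (pedges a) => //= e p /andP[/eqP].
Qed.

Lemma xnth_cat a x n : ptgt a = xsrc x ->
  xnth (xcat a x) n =
  if (n < plen a)%N then onth (pedges a) n else xnth x (n - plen a).
Proof.
case: x => [y|z] h.
  by have [y' -> /= ->] := xcat_fin h; rewrite pedges_cat// onth_cat.
have [z' -> /= ->] := xcat_inf h; rewrite /stream_cat.
by case: ifPn => // na; rewrite onthE (nth_map (val z 0%N)).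
Qed.

Lemma xcatA a b x : ptgt a = psrc b -> ptgt b = xsrc x ->
  xcat (pcat a b) x = xcat a (xcat b x).
Proof.
move=> ab bx; have abx : ptgt (pcat a b) = xsrc x by rewrite ptgt_cat.
have abx' : ptgt a = xsrc (xcat b x) by rewrite xsrc_cat.
apply: xext; first by rewrite !xsrc_cat// psrc_cat.
move=> n; rewrite !xnth_cat// plen_cat// pedges_cat// onth_cat.
case: (ltnP n (plen a)) => na; first by rewrite ltn_addr.
by rewrite ltn_subLR// subnDA.
Qed.

Lemma xcat_injl a x y : ptgt a = xsrc x -> ptgt a = xsrc y ->
  xcat a x = xcat a y -> x = y.
Proof.
move=> ax ay e; apply: xext; first by rewrite -ax.
move=> n; have := congr1 (fun x => xnth x (plen a + n)) e.
by rewrite /= !xnth_cat// ltnNge leq_addr /= addKn.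
Qed.

End Paths.

Section Groupoid.
Variable E : digraph.
Implicit Types (a b c d m : finpath E) (x y : bpath E).

Definition pathgroupoid_set : set (bpath E * int * bpath E) :=
  [set g | exists a b x, [/\ ptgt a = ptgt b, ptgt b = xsrc x &
    g = (xcat a x, (plen a)%:Z - (plen b)%:Z, xcat b x)]].

Definition pathgroupoid := {g | `[< pathgroupoid_set g >]}.
Local Notation G := pathgroupoid.
HB.instance Definition _ := Choice.on G.
HB.instance Definition _ := SubType.on G.

Definition grng (g : G) : bpath E := (val g).1.1.
Definition gdeg (g : G) : int := (val g).1.2.
Definition gsrc (g : G) : bpath E := (val g).2.

(* The pair (k, l) is composable and its product is g. *)
Definition is_gmul (k l g : G) : Prop :=
  gsrc k = grng l /\ val g = (grng k, gdeg k + gdeg l, gsrc l).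

Lemma ginv_subproof (g : G) :
  `[< pathgroupoid_set (gsrc g, - gdeg g, grng g) >].
Proof.
rewrite /gsrc /gdeg /grng; case: g => g /= /asboolP[a [b [x [ab bx ->]]]] /=.
by apply/asboolP; exists b, a, x; rewrite ab opprB.
Qed.
Definition ginv (g : G) : G :=
  exist (fun g => `[< pathgroupoid_set g >]) _ (ginv_subproof g).

Lemma ginvK : involutive ginv.
Proof.
by case=> -[[x n] y] h; apply: val_inj; rewrite /= /gdeg /= opprK.
Qed.

(* The set A'_(a,b), for ptgt a = ptgt b. *)
Definition cyl a b : set G :=
  [set g | exists2 x, ptgt b = xsrc x &
    val g = (xcat a x, (plen a)%:Z - (plen b)%:Z, xcat b x)].

Definition basic a b (ms : seq (finpath E)) : set G :=
  cyl a b `\` \bigcup_(m in [set` ms]) cyl (pcat a m) (pcat b m).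

Definition basics : set (set G) :=
  [set B | exists a b ms, [/\ ptgt a = ptgt b,
    (forall m, m \in ms -> psrc m = ptgt a) & B = basic a b ms]].

Lemma cyl_cat a b m : ptgt a = ptgt b -> ptgt a = psrc m ->
  cyl (pcat a m) (pcat b m) `<=` cyl a b.
Proof.
move=> ab am g [x mx gE]; have bm : ptgt b = psrc m by rewrite -ab.
have mx' : ptgt m = xsrc x by rewrite -mx ptgt_cat.
exists (xcat m x); first by rewrite xsrc_cat.
rewrite gE !xcatA// !plen_cat// !PoszD; congr (_, _, _).
by rewrite opprD addrACA subrr addr0.
Qed.

Lemma cyl_nested a b c d g : ptgt a = ptgt b -> ptgt c = ptgt d ->
  cyl a b g -> cyl c d g -> (plen a <= plen c)%N ->
  exists m, [/\ ptgt a = psrc m, c = pcat a m & d = pcat b m].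
Proof.
move=> ab cd [x bx gx] [y dy]; rewrite gx => -[acE lE bdE] lac.
have ax : ptgt a = xsrc x by rewrite ab.
have cy : ptgt c = xsrc y by rewrite cd.
have lE' : (plen a + plen d = plen c + plen b)%N by lia.
have lbd : (plen b <= plen d)%N by lia.
have pre (p q : finpath E) : ptgt p = xsrc x -> ptgt q = xsrc y ->
    xcat p x = xcat q y -> (plen p <= plen q)%N ->
    exists2 m, ptgt p = psrc m & q = pcat p m.
  move=> px qy e lpq; apply/is_prefixP; rewrite /is_prefix.
  rewrite -(xsrc_cat px) e xsrc_cat// eqxx /=.
  apply/prefixP; exists (drop (plen p) (pedges q)).
  rewrite -[LHS](cat_take_drop (plen p)); congr (_ ++ _).
  apply: eq_from_onth => n.
  have [np|np] := ltnP n (plen p); last first.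
    by rewrite !onth_default// size_take -/(plen q); case: ifP => //; lia.
  have := congr1 (fun x => xnth x n) e; rewrite /= !xnth_cat// np.
  rewrite (leq_trans np lpq) => ->.
  by rewrite !onthE map_take nth_take.
have [m am cE] := pre _ _ ax cy acE lac.
have [m' bm dE] := pre _ _ bx dy bdE lbd.
exists m; split => //; rewrite dE; congr pcat.
have sm : psrc m' = psrc m by rewrite -bm -am.
have lm : plen m' = plen m.
  by move: lE'; rewrite cE dE !plen_cat//; lia.
have tm : ptgt m = ptgt c by rewrite cE ptgt_cat.
have tm' : ptgt m' = ptgt d by rewrite dE ptgt_cat.
have xm : x = xcat m y.
  apply: (@xcat_injl E a) => //; first by rewrite xsrc_cat// tm.
  by rewrite -xcatA ?tm// -cE.
have xm' : x = xcat m' y.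
  apply: (@xcat_injl E b) => //; first by rewrite xsrc_cat// tm'.
  by rewrite -xcatA ?tm'// -dE.
apply: finpath_inj => //; apply: eq_from_onth => n.
have [nm|nm] := ltnP n (plen m); last by rewrite !onth_default// -/(plen _) lm.
have := congr1 (fun x => xnth x n) (etrans (esym xm) xm').
by rewrite /= !xnth_cat ?tm ?tm'// lm nm.
Qed.

Lemma basics_cover : \bigcup_(B in basics) id B = setT.
Proof.
apply/seteqP; split => // g _.
have /asboolP[a [b [x [ab bx gE]]]] := valP g.
exists (basic a b [::]); first by exists a, b, [::].
by split; [exists x | case].
Qed.

Lemma basics_join (B1 B2 : set G) t : basics B1 -> basics B2 ->
  id B1 t -> id B2 t ->
  exists B, [/\ basics B, id B t & id B `<=` id B1 `&` id B2].
Proof.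
move=> [a [b [ms [ab hms ->]]]] [c [d [ns [cd hns ->]]]] /=.
wlog lac : a b ms ab hms c d ns cd hns / (plen a <= plen c)%N.
  move=> W; have [|/ltnW] := leqP (plen a) (plen c); first exact: W.
  move=> /(W c d ns cd hns a b ms ab hms) {}W t1 t2.
  have [B [hB Bt Bs]] := W t2 t1.
  by exists B; split => //; rewrite setIC.
move=> [tab tms] [tcd tns].
have [m [am cE dE]] := cyl_nested ab cd tab tcd lac.
have bm : ptgt b = psrc m by rewrite -ab.
have cat_quot u : u \in ms -> is_prefix m u -> exists2 w,
    [/\ pquot m u = w & ptgt c = psrc w] &
    pcat a u = pcat c w /\ pcat b u = pcat d w.
  move=> ums /is_prefixP[w mw uE]; exists w.
    by rewrite uE pquot_cat// cE ptgt_cat.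
  by rewrite uE cE dE !pcatA.
pose ks := ns ++ [seq pquot m u | u <- ms & is_prefix m u].
exists (basic c d ks); split.
- exists c, d, ks; split => // u; rewrite mem_cat => /orP[/hns//|].
  move=> /mapP[w]; rewrite mem_filter => /andP[mw wms] ->.
  by have [k [-> ->]] := cat_quot _ wms mw.
- split=> //= -[u /=]; rewrite mem_cat => /orP[uns|].
    by move=> tu; apply: tns; exists u.
  move=> /mapP[w]; rewrite mem_filter => /andP[mw wms] ->.
  have [k [-> ck] [e1 e2]] := cat_quot _ wms mw.
  by rewrite -e1 -e2 => tw; apply: tms; exists w.
- move=> g [gcd gks]; split; split => //.
  + by move: gcd; rewrite cE dE; apply: cyl_cat.
  + move=> -[u /= ums gu].
    have au : ptgt a = psrc u by rewrite hms.
    have bu : ptgt b = psrc u by rewrite -ab.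
    have abu : ptgt (pcat a u) = ptgt (pcat b u) by rewrite !ptgt_cat.
    have [luc|/ltnW luc] := leqP (plen (pcat a u)) (plen c).
      have [w [uw cw dw]] := cyl_nested abu cd gu gcd luc.
      apply: tms; exists u => //; apply: (@cyl_cat _ _ w) => //.
      by rewrite -cw -dw.
    have [w [cw e1 e2]] := cyl_nested cd abu gcd gu luc.
    have mw : ptgt m = psrc w by rewrite -cw cE ptgt_cat.
    have uE : u = pcat m w.
      apply: (@pcat_injr E a) => //; first by rewrite psrc_cat.
      by rewrite e1 cE pcatA.
    apply: gks; exists w; last by rewrite /= -e1 -e2.
    rewrite /ks /= mem_cat; apply/orP; right; apply/mapP; exists u.
      by rewrite mem_filter ums andbT; apply/is_prefixP; exists w.
    by rewrite uE pquot_cat.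
  + by move=> -[u uns gu]; apply: gks; exists u => //=; rewrite mem_cat uns.
Qed.

HB.instance Definition _ :=
  isBaseTopological.Build G basics_cover basics_join.

End Groupoid.

Section GroupoidTopology.
Variable E : digraph.
Local Notation G := (pathgroupoid E).

Lemma basics_open (B : set G) : basics B -> open B.
Proof. by move=> h; exists [set B]; [move=> _ ->|rewrite bigcup_set1]. Qed.

Lemma open_basics (A : set G) g : open A -> A g ->
  exists B, [/\ basics B, B g & B `<=` A].
Proof.
by move=> [D h <-] [B DB Bg]; exists B; split=> //;
  [exact: h|exact: bigcup_sup].
Qed.

Lemma cyl_basics (a b : finpath E) : ptgt a = ptgt b -> basics (cyl a b).
Proof.
move=> ab; exists a, b, [::]; split => //.
rewrite /basic (_ : [set` [::]] = set0) ?bigcup_set0 ?setD0//.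
by apply/seteqP; split.
Qed.

Lemma cyl_open (a b : finpath E) : ptgt a = ptgt b -> open (cyl a b).
Proof. by move=> ab; apply/basics_open/cyl_basics. Qed.

Lemma cyl_closed (a b : finpath E) : ptgt a = ptgt b -> closed (cyl a b).
Proof.
move=> ab; rewrite -openC openE => g gab.
have /asboolP[c [d [x [cd dx gE]]]] := valP g.
have gcd : cyl c d g by exists x.
have [lac|/ltnW lca] := leqP (plen a) (plen c).
  exists (cyl c d); split=> //; first exact: cyl_open.
  move=> h hcd hab; apply: gab.
  have [m [am cE dE]] := cyl_nested ab cd hab hcd lac.
  by apply: (cyl_cat ab am); rewrite -cE -dE.
have [[m [cm aE bE]]|nm] := pselect (exists m,
    [/\ ptgt c = psrc m, a = pcat c m & b = pcat d m]).
  exists (basic c d [:: m]); split.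
  - apply: basics_open; exists c, d, [:: m]; split=> // u.
    by rewrite inE => /eqP ->.
  - by split=> //= -[u /=]; rewrite inE => /eqP ->; rewrite -aE -bE.
  - move=> h [hcd hm] hab; apply: hm; exists m; rewrite /= ?inE//.
    by rewrite -aE -bE.
exists (cyl c d); split=> //; first exact: cyl_open.
by move=> h hcd hab; apply: nm; exact: (cyl_nested cd ab hcd hab lca).
Qed.

Lemma ultra_cylP (F : set_system G) g : UltraFilter F ->
  (forall c d, ptgt c = ptgt d -> F (cyl c d) <-> cyl c d g) -> F --> g.
Proof.
move=> UF FE A; rewrite nbhsE => -[U [oU Ug] UA].
have [B [[c [d [ms [cd hms ->]]]] [gcd gms] BU]] := open_basics oU Ug.
apply: filterS UA _; apply: filterS BU _.
rewrite /basic setDE setC_bigcup; apply: filterI; first exact/FE.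
have : forall m, m \in ms -> F (~` cyl (pcat c m) (pcat d m)).
  move=> m mms; have cm : ptgt c = psrc m by rewrite hms.
  have dm : ptgt d = psrc m by rewrite -cd.
  have [|//] := in_ultra_setVsetC (cyl (pcat c m) (pcat d m)) UF.
  rewrite FE ?ptgt_cat// => h; case: gms; by exists m.
elim: ms {hms gms} => [|m ms IH] h.
  rewrite (_ : [set` [::]] = set0) ?bigcap_set0; first exact: filterT.
  by apply/seteqP; split.
have Fm : F (~` cyl (pcat c m) (pcat d m)) by apply: h; rewrite inE eqxx.
have Fms : F (\bigcap_(m in [set` ms]) ~` cyl (pcat c m) (pcat d m)).
  by apply: IH => u ums; apply: h; rewrite inE ums orbT.
apply: filterS (filterI Fm Fms) => k [km kms] u /=.
by rewrite inE => /predU1P[->//|]; exact: kms.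
Qed.

Lemma pcat_vpath (a : finpath E) : pcat a (vpath (ptgt a)) = a.
Proof. by apply: finpath_inj; rewrite ?psrc_cat// pedges_cat// cats0. Qed.

Lemma finpath_cons (m : finpath E) : (0 < plen m)%N ->
  exists e m', [/\ esrc e = psrc m, etgt e = psrc m' &
                   m = pcat (epath e) m'].
Proof.
case: m => -[v [//|e p]] /= w _; have /andP[/eqP ev wp] := w.
exists e, (exist _ (etgt e, p) wp); split => //.
by apply: finpath_inj; rewrite ?psrc_cat// pedges_cat.
Qed.

Lemma zshift_subproof n (z : ipath E) :
  `[< forall i, etgt (val z (i + n)%N) = esrc (val z (i.+1 + n)%N) >].
Proof. by apply/asboolP => i; have /asboolP := valP z; apply. Qed.
Definition zshift n (z : ipath E) : ipath E :=
  exist (fun z => `[< forall i, etgt (z i) = esrc (z i.+1) >])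
    (fun i => val z (i + n)%N) (zshift_subproof n z).

Lemma zshiftS n (z : ipath E) :
  inr (zshift n z) = xcat (epath (val z n)) (inr (zshift n.+1 z)) :> bpath E.
Proof.
have h : ptgt (epath (val z n)) = xsrc (inr (zshift n.+1 z)).
  by have /asboolP := valP z; apply.
apply: xext; first by rewrite xsrc_cat.
by move=> [|i]; rewrite xnth_cat//= subn1 /= addnS addSn.
Qed.

Lemma xcase (x : bpath E) :
  (exists2 y : Yinf E, x = inl y & val y = vpath (xsrc x)) \/
  exists e x', [/\ esrc e = xsrc x, etgt e = xsrc x' & x = xcat (epath e) x'].
Proof.
case: x => [y|z]; last first.
  right; exists (val z 0%N), (inr (zshift 1 z)); split => //.
    by have /asboolP := valP z; apply.
  rewrite -zshiftS; congr inr; apply: val_inj; apply/funext => i /=.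
  by rewrite addn0.
have [y0|y0] := posnP (plen (val y)).
  left; exists y => //; apply: finpath_inj => //.
  exact: size0nil.
have [e [m [em me yE]]] := finpath_cons y0.
have hm : `[< Vinf (ptgt m) >].
  by have := valP y; rewrite yE ptgt_cat.
right; exists e, (inl (exist _ m hm)); split => //.
have me' : ptgt (epath e) = psrc m by [].
have [y' -> y'E] := @xcat_fin E (epath e) (exist _ m hm) me'.
by congr inl; apply: val_inj; rewrite y'E.
Qed.

Lemma ultra_leaf (F : set_system G) c d : UltraFilter F -> ptgt c = ptgt d ->
  F (cyl c d) ->
  (forall e, esrc e = ptgt c ->
    ~ F (cyl (pcat c (epath e)) (pcat d (epath e)))) ->
  exists2 g, cyl c d g & F --> g.
Proof.
move=> UF cd Fcd Fe.
have vinf : `[< Vinf (ptgt (vpath (ptgt c))) >].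
  apply/asboolP => /= fin.
  have : F (\bigcap_(e in out (ptgt c))
      ~` cyl (pcat c (epath e)) (pcat d (epath e))).
    have /finite_fsetP[D DE] := fin; rewrite DE.
    apply: filter_bigI => e eD.
    have ec : esrc e = ptgt c by have : out (ptgt c) e by rewrite DE.
    have [/(Fe _ ec)//|//] :=
      in_ultra_setVsetC (cyl (pcat c (epath e)) (pcat d (epath e))) UF.
  move=> /(filterI Fcd) /filter_ex[g [[x dx gE] ng]].
  have [[y xE yE]|[e [x' [ex ex' xE]]]] := xcase x.
    have /asboolP := valP y; rewrite yE /ptgt /= -dx -cd; exact.
  have ec : esrc e = ptgt c by rewrite ex cd dx.
  have ed : ptgt d = psrc (epath e) by rewrite dx.
  apply: (ng e ec); exists x'; first by rewrite ptgt_cat.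
  rewrite gE xE !xcatA// !plen_cat//.
  by congr (_, _, _); rewrite !PoszD opprD addrACA subrr addr0.
pose y0 : Yinf E := exist _ (vpath (ptgt c)) vinf.
pose x0 : bpath E := inl y0.
have gh : `[< pathgroupoid_set
    (xcat c x0, (plen c)%:Z - (plen d)%:Z, xcat d x0) >].
  by apply/asboolP; exists c, d, x0; rewrite -cd.
pose g : G := exist (fun g => `[< pathgroupoid_set g >]) _ gh.
have gcd : cyl c d g by exists x0; rewrite -?cd.
exists g => //; apply: ultra_cylP => c' d' cd'; split=> h.
  have [k [k1 k2]] := filter_ex (filterI Fcd h).
  have [lc|lc] := leqP (plen c') (plen c).
    have [m [cm cE dE]] := cyl_nested cd' cd k2 k1 lc.
    by apply: (cyl_cat cd' cm); rewrite -cE -dE.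
  have [m [cm cE dE]] := cyl_nested cd cd' k1 k2 (ltnW lc).
  have dm : ptgt d = psrc m by rewrite -cd.
  have m0 : (0 < plen m)%N by move: lc; rewrite cE plen_cat//; lia.
  have [e [m' [em em' mE]]] := finpath_cons m0.
  have ce : ptgt c = psrc (epath e) by rewrite cm.
  have de : ptgt d = psrc (epath e) by rewrite -cd.
  case: (Fe e) => //; apply: filterS h; rewrite cE dE mE -!pcatA//.
  by apply: cyl_cat; rewrite !ptgt_cat.
suff lc : (plen c' <= plen c)%N.
  have [m [cm cE dE]] := cyl_nested cd' cd h gcd lc.
  by apply: filterS Fcd; rewrite cE dE; apply: cyl_cat.
rewrite leqNgt; apply/negP => lc.
have [x dx [xE _ _]] := h.
have cx : ptgt c' = xsrc x by rewrite cd'.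
have : xnth (xcat c x0) (plen c) = xnth (xcat c' x) (plen c) by rewrite -xE.
rewrite !xnth_cat// ltnn subnn lc => /= cn.
by move: lc; rewrite /plen -onthTE -/(plen c) -cn.
Qed.

Lemma cyl_compact (a b : finpath E) : ptgt a = ptgt b -> compact (cyl a b).
Proof.
move=> ab; rewrite compact_ultra => F UF Fab.
pose T m := ptgt a = psrc m /\ F (cyl (pcat a m) (pcat b m)).
have [[m [[am Fm] nm]]|hT] := pselect (exists m, T m /\
    forall e, esrc e = ptgt m -> ~ T (pcat m (epath e))).
  have bm : ptgt b = psrc m by rewrite -ab.
  have abm : ptgt (pcat a m) = ptgt (pcat b m) by rewrite !ptgt_cat.
  have [e|g hg Fg] := ultra_leaf UF abm Fm.
    rewrite ptgt_cat// => em; rewrite !pcatA//.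
    by move=> h; apply: (nm e em); split; rewrite ?psrc_cat.
  by exists g; split => //; exact: (cyl_cat ab am hg).
have T0 : T (vpath (ptgt a)) by split=> //; rewrite {2}ab !pcat_vpath.
pose R (p q : {m | T m}) := exists2 e, esrc e = ptgt (sval p) &
  sval q = pcat (sval p) (epath e).
have Rex (p : {m | T m}) : {q : {m | T m} | R p q}.
  apply: cid; apply: contrapT => np; apply: hT; exists (sval p).
  split; first exact: (svalP p).
  by move=> e em Te; apply: np; exists (exist _ _ Te); exists e.
have [f [f0 fS]] := dependent_choice Rex (exist _ _ T0).
have /choice[z0 z0E] : forall n, exists e, esrc e = ptgt (sval (f n)) /\
    sval (f n.+1) = pcat (sval (f n)) (epath e).
  by move=> n; have [e h1 h2] := fS n; exists e.
have zh : `[< forall i, etgt (z0 i) = esrc (z0 i.+1) >].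
  apply/asboolP => i; have [ei fi] := z0E i; have [-> _] := z0E i.+1.
  by rewrite fi ptgt_cat.
pose z : ipath E :=
  exist (fun z => `[< forall i, etgt (z i) = esrc (z i.+1) >]) _ zh.
pose x n : bpath E := inr (zshift n z).
have tf n : ptgt (sval (f n)) = xsrc (x n) by have [<- _] := z0E n.
have sf n : psrc (sval (f n)) = ptgt a by have [] := svalP (f n).
have fx n : xcat (sval (f n)) (x n) = x 0%N.
  elim: n => [|n <-].
    apply: xext; first by rewrite xsrc_cat// f0 -tf f0.
    by move=> i; rewrite xnth_cat// f0 /= subn0.
  have [en fn] := z0E n.
  rewrite fn xcatA//; last by have /asboolP := zh; apply.
  by congr xcat; rewrite [RHS]zshiftS.
have lf n : plen (sval (f n)) = n.
  elim: n => [|n IH]; first by rewrite f0.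
  by have [en ->] := z0E n; rewrite plen_cat// IH addn1.
have ax : ptgt a = xsrc (x 0%N) by rewrite -tf f0.
have gh : `[< pathgroupoid_set
    (xcat a (x 0%N), (plen a)%:Z - (plen b)%:Z, xcat b (x 0%N)) >].
  by apply/asboolP; exists a, b, (x 0%N); rewrite -ab.
pose g : G := exist (fun g => `[< pathgroupoid_set g >]) _ gh.
have gf n : cyl (pcat a (sval (f n))) (pcat b (sval (f n))) g.
  exists (x n); first by rewrite ptgt_cat// -ab.
  rewrite !xcatA ?fx ?tf -?ab// !plen_cat -?ab//.
  by congr (_, _, _); rewrite !PoszD opprD addrACA subrr addr0.
exists g; split; first by exists (x 0%N); rewrite -?ab.
apply: ultra_cylP => c d cd.
have [an Fn] := svalP (f (plen c)); have gn := gf (plen c).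
have abn : ptgt (pcat a (sval (f (plen c)))) =
  ptgt (pcat b (sval (f (plen c)))) by rewrite !ptgt_cat -?ab.
have ln : (plen c <= plen (pcat a (sval (f (plen c)))))%N.
  by rewrite plen_cat// lf leq_addl.
suff sub k : cyl c d k -> cyl (pcat a (sval (f (plen c))))
    (pcat b (sval (f (plen c)))) k ->
    cyl (pcat a (sval (f (plen c)))) (pcat b (sval (f (plen c)))) `<=` cyl c d.
  split=> [h|/sub/(_ gn) h]; last exact: filterS h Fn.
  have [k [k1 k2]] := filter_ex (filterI Fn h).
  exact: (sub k k2 k1).
move=> h1 h2; have [m [cm -> ->]] := cyl_nested cd abn h1 h2 ln.
exact: cyl_cat.
Qed.

Lemma ginv_cyl (a b : finpath E) : ptgt a = ptgt b ->
  @ginv E @^-1` cyl a b = cyl b a.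
Proof.
move=> ab.
suff sub c d : ptgt c = ptgt d -> @ginv E @^-1` cyl c d `<=` cyl d c.
  apply/seteqP; split; first exact: sub.
  by move=> g h; apply: sub => //=; rewrite ginvK.
move=> cd -[[[x n] y] h] [w dw]; rewrite /= /gdeg /gsrc /grng /= => -[yE nE xE].
by exists w; rewrite ?cd// -xE -yE -opprB -nE opprK.
Qed.

Lemma ginv_continuous : continuous (@ginv E).
Proof.
apply/continuousP => A [D hD <-]; rewrite preimage_bigcup.
apply: bigcup_open => B DB; have [a [b [ms [ab hms ->]]]] := hD _ DB.
rewrite (_ : _ @^-1` _ = basic b a ms); last first.
  have e : \bigcup_(m in [set` ms]) cyl (pcat b m) (pcat a m) =
      @ginv E @^-1` \bigcup_(m in [set` ms]) cyl (pcat a m) (pcat b m).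
    rewrite preimage_bigcup; apply: eq_bigcupr => m mms.
    by rewrite ginv_cyl// !ptgt_cat -?ab// hms.
  by rewrite /basic e -(ginv_cyl ab); apply/seteqP; split.
apply: basics_open; exists b, a, ms; split=> [//|m /hms ->//|//].
Qed.

End GroupoidTopology.

Section CompactlySupported.
Variables (R : realType) (E : digraph).
Local Notation C := R[i].
Local Notation G := (pathgroupoid E).

Definition Ccfun : {pred G -> C^o} :=
  fun f => `[< continuous f /\ compact (closure [set g | f g != 0]) >].

Lemma Ccfun_submod_closed : submod_closed Ccfun.
Proof.
split.
  apply/asboolP; split; first exact: cst_continuous.
  rewrite (_ : [set g | _] = set0) ?closure0; first exact: compact0.
  by apply/seteqP; split => // g; rewrite /= eqxx.
move=> k f h /asboolP[cf sf] /asboolP[ch sh]; apply/asboolP; split.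
  move=> g; apply: continuousD; last exact: ch.
  exact: (@cvgZl_tmp _ _ _ _ _ k _ _ (cf g)).
apply: subclosed_compact (compactU sf sh) _; first exact: closed_closure.
rewrite -closureU; apply: closure_subset => g /=.
have -> : (k *: f + h) g = k * f g + h g by [].
have [->|fg _] := eqVneq (f g) 0; last by left.
by rewrite mulr0 add0r; right.
Qed.

Lemma conjC_continuous : continuous (fun z : C^o => z^* : C^o).
Proof.
move=> z; apply/(@cvgrPdist_lt _ C^o _ (nbhs (z : C^o))) => e e0.
have /cvgrPdist_lt/(_ e e0) : (w : C^o) @[w --> (z : C^o)] --> (z : C^o).
  exact: cvg_id.
by apply: filterS => w; rewrite -rmorphB norm_conjC.
Qed.

Record Cc := MkCc { Cc_fun :> G -> C^o ; _ : Cc_fun \in Ccfun }.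

HB.instance Definition _ := [isSub for Cc_fun].
HB.instance Definition _ := [Choice of Cc by <:].
HB.instance Definition _ := GRing.isSubmodClosed.Build _ _ Ccfun
  Ccfun_submod_closed.
HB.instance Definition _ := [SubChoice_isSubLmodule of Cc by <:].

(* (f * h)(g) is the sum of the f k * h l over the factorizations g = k l. For
   f and h in C_c(G) only finitely many terms are nonzero, as the groupoid is
   etale, and the convolution is again in C_c(G). *)
Definition convol (f h : G -> C^o) (g : G) : C^o :=
  \sum_(kl \in [set kl : G * G | is_gmul kl.1 kl.2 g]) f kl.1 * h kl.2.

Lemma Cc_star_subproof (f : Cc) : (fun g => (f (ginv g))^*) \in Ccfun.
Proof.
have /asboolP[cf sf] := valP f; apply/asboolP; split.
  move=> g; apply: (@continuous_comp _ _ _ (f \o @ginv E)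
    (fun z : C^o => z^* : C^o)); last exact: conjC_continuous.
  by apply: continuous_comp; [exact: ginv_continuous|exact: cf].
have sub : closure [set g | (f (ginv g))^* != 0] `<=`
    @ginv E @` closure [set g | f g != 0].
  move=> g cg; exists (ginv g); last exact: ginvK.
  move=> B /ginv_continuous /cg[h [/= fh Bh]]; exists (ginv h); split=> //=.
  by move: fh; rewrite conjC_eq0.
apply: subclosed_compact _ sub; first exact: closed_closure.
apply: continuous_compact => //; apply: continuous_subspaceT.
exact: ginv_continuous.
Qed.

Definition Cc_star (f : Cc) : Cc := MkCc (Cc_star_subproof f).

Lemma cyl_indic_subproof (a b : finpath E) : ptgt a = ptgt b ->
  (\1_(cyl a b) : G -> C^o) \in Ccfun.
Proof.
move=> ab; apply/asboolP; split; last first.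
  apply: subclosed_compact (cyl_compact ab) _; first exact: closed_closure.
  rewrite [X in _ `<=` X](closure_id _).1; last exact: cyl_closed.
  apply: closure_subset => g /=; rewrite indicE.
  by case: (boolP (g \in _)) => [/set_mem//|]; rewrite eqxx.
apply/continuousP => A _.
have oI (B : set C^o) : open [set g : G | cyl a b g /\ B 1].
  have [B1|B1] := pselect (B 1).
    rewrite (_ : mkset _ = cyl a b); first exact: cyl_open.
    by apply/seteqP; split=> g //= -[].
  by rewrite (_ : mkset _ = set0); [exact: open0|apply/seteqP; split=> g // -[]].
have oO (B : set C^o) : open [set g : G | ~ cyl a b g /\ B 0].
  have [B1|B1] := pselect (B 0).
    rewrite (_ : mkset _ = ~` cyl a b).
      by rewrite openC; exact: cyl_closed.
    by apply/seteqP; split=> g //= -[].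
  by rewrite (_ : mkset _ = set0); [exact: open0|apply/seteqP; split=> g // -[]].
rewrite (_ : _ @^-1` A = [set g | cyl a b g /\ A 1] `|`
  [set g | ~ cyl a b g /\ A 0]); first exact: openU.
apply/seteqP; split=> g /=; rewrite indicE.
  case: (boolP (g \in _)) => [/set_mem ?|n ?]; [by left|right].
  by split => // h; move: n; rewrite mem_set.
by move=> [[h]|[h]] Ax; [rewrite mem_set|rewrite memNset].
Qed.

(* The indicator function of A'_(a,b) at s = (a, b), and 0 at the zero of the
   semigroup. *)
Definition chi (s : gis E) : Cc :=
  if s is Some p then MkCc (cyl_indic_subproof (eqP (valP p))) else 0.

Definition I_norm (f : Cc) : \bar R :=
  maxe
    (ereal_sup [set \esum_(g in [set g | grng g = u]) (Normc.normc (f g))%:E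
               | u in [set: bpath E]])
    (ereal_sup [set \esum_(g in [set g | gsrc g = u]) (Normc.normc (f g))%:E
               | u in [set: bpath E]]).

End CompactlySupported.

(* Complex Hilbert spaces; the inner product is linear in its first argument
   and conjugate-linear in the second one. *)
Record hilbertType (R : realType) := HilbertType {
  hcarrier :> completeNormedModType R[i] ;
  hdot : {dot hcarrier for Num.conj} ;
  hdotE : forall x : hcarrier, `|x| ^+ 2 = hdot x x }.

Record bop (R : realType) (H : hilbertType R) := Bop {
  bop_fun :> {linear H -> H} ;
  bop_cont : continuous bop_fun }.

Section Representations.
Variables (R : realType) (H : hilbertType R).

Definition is_adjoint (S T : bop H) :=
  forall x y, hdot H (S x) y = hdot H x (T y).

Definition is_projection (P : bop H) :=
  (forall x, P (P x) = P x) /\ is_adjoint P P.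

Definition is_partial_isometry (S : bop H) :=
  forall x, (forall y, S y = 0 -> hdot H x y = 0) -> `|S x| = `|x|.

Definition nondegenerate (I : Type) (T : I -> bop H) :=
  dense [set x : H | exists s : seq (I * H), x = \sum_(p <- s) T p.1 p.2].

Variable E : digraph.

(* Sa e is the adjoint of S e: adjoints are given by the relation is_adjoint,
   which determines Sa e uniquely, and every bounded operator on a Hilbert
   space has an adjoint. For non-degeneracy only the P v matter, since the range
   of S e is contained in that of P (esrc e). *)
Record is_graph_rep (P : vertex E -> bop H) (S Sa : edge E -> bop H) : Prop := {
  gr_proj : forall v, is_projection (P v) ;
  gr_orth : forall v w, v != w -> forall x, P v (P w x) = 0 ;
  gr_piso : forall e, is_partial_isometry (S e) ;
  gr_adj : forall e, is_adjoint (S e) (Sa e) ;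
  gr_range_orth : forall e f, e != f ->
    forall x, S e (Sa e (S f (Sa f x))) = 0 ;
  gr_init : forall e x, Sa e (S e x) = P (etgt e) x ;
  gr_sum : forall v, Vfin v ->
    forall x, P v x = \sum_(e \in out v) S e (Sa e x) ;
  gr_range : forall e x, P (esrc e) (S e (Sa e x)) = S e (Sa e x) ;
  gr_nondeg : nondegenerate P }.

Definition graph_reps : set ((vertex E -> bop H) * (edge E -> bop H)) :=
  [set PS | exists Sa, is_graph_rep PS.1 PS.2 Sa].

(* sr_sum says that the linear extension of Pi vanishes on
   v - \sum_(esrc e = v) (e, e). *)
Record is_gis_rep (Pi : gis E -> bop H) : Prop := {
  sr_mul : forall s t x, Pi (smul s t) x = Pi s (Pi t x) ;
  sr_star : forall s, is_adjoint (Pi s) (Pi (sstar s)) ;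
  sr_zero : forall x, Pi None x = 0 ;
  sr_sum : forall v, Vfin v -> forall x,
    Pi (spp (vpath v) (vpath v)) x -
    \sum_(e \in out v) Pi (spp (epath e) (epath e)) x = 0 ;
  sr_nondeg : nondegenerate Pi }.

Definition gis_reps : set (gis E -> bop H) := [set Pi | is_gis_rep Pi].

(* Non-degenerate *-representations of C_c(G); pr_cont is the continuity from
   the I-norm to the operator norm. *)
Record is_groupoid_rep (pi : Cc R E -> bop H) : Prop := {
  pr_linear : forall (c : R[i]) (f h : Cc R E) (x : H),
    pi (c *: f + h) x = c *: pi f x + pi h x ;
  pr_mul : forall f h k : Cc R E, (k : _ -> _) = convol f h ->
    forall x, pi k x = pi f (pi h x) ;
  pr_star : forall f, is_adjoint (pi f) (pi (Cc_star f)) ;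
  pr_cont : forall (f : Cc R E) (eps : R), 0 < eps ->
    exists2 delta : R, 0 < delta & forall h : Cc R E,
      (I_norm (h - f)%R < delta%:E)%E ->
      forall x : H, `|pi h x - pi f x| <= eps%:C%C * `|x| ;
  pr_nondeg : nondegenerate pi }.

Definition groupoid_reps : set (Cc R E -> bop H) :=
  [set pi | is_groupoid_rep pi].

End Representations.

(* Main.v *)
(* From a representation (P, S) of the graph one gets the representation
   (a, b) |-> S_a S_b^* of the semigroup, where S_a = S_(e1) ... S_(ek) P_(r(a))
   for a = e1 ... ek.

   The combinations of the indicators chi_s are dense in C_c(G) for the I-norm,
   so a representation Pi of the semigroup extends uniquely to C_c(G) once
     |\sum_i c_i Pi(s_i)| <= I_norm (\sum_i c_i chi_(s_i)).
   To prove this, cut the cylinders of the s_i into disjoint pieces on which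
   f = \sum_i c_i chi_(s_i) is constant; accordingly \sum_i c_i Pi(s_i) is a
   combination of partial isometries with the values of f as coefficients. The
   Schur test then reduces the estimate to positive combinations of the initial
   (or final) projections, which all lie in the Boolean algebra generated by the
   commuting projections Pi(b, b). A nonzero vector x in the range of Pi(b, b)
   which is killed by finitely many Pi(c, c) yields a point of X in the cylinder
   of b and outside those of the paths c, because of the relations at finite
   emitters; at this point the definition of the I-norm bounds the sum of the
   coefficients of the projections that fix x. *)
Require Import Defs.
From HB Require Import structures.
From mathcomp Require Import all_boot all_order all_algebra.
From mathcomp Require Import all_classical all_reals all_analysis.
From mathcomp Require Import complex zify.

Set Implicit Arguments.
Unset Strict Implicit.
Unset Printing Implicit Defensive.

Import Order.TTheory GRing.Theory Num.Theory.
Import numFieldNormedType.Exports.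

Local Open Scope classical_set_scope.
Local Open Scope ring_scope.

(** * Operators on a Hilbert space *)

Section Operators.
Variables (R : realType) (H : hilbertType R).
Local Notation C := R[i].
Implicit Types (x y z : H) (S T U V : bop H).
Local Notation "''[' x , y ]" := (hdot H x y).

Lemma hdotC x y : '[x, y] = '[y, x]^*.
Proof. by rewrite hermC mul1r. Qed.

Lemma hdot_injl x y : (forall z, '[x, z] = '[y, z]) -> x = y.
Proof.
move=> h; apply/eqP; rewrite -subr_eq0 -(dnorm_eq0 (hdot H)).
by rewrite linearBl /= h subrr.
Qed.

Lemma hdot_injr x y : (forall z, '[z, x] = '[z, y]) -> x = y.
Proof. by move=> h; apply: hdot_injl => z; rewrite hdotC h -hdotC. Qed.

Lemma bop_ext S T : (forall x, S x = T x) -> S = T.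
Proof.
case: S T => [S cS] [T cT] /= h.
have e : S = T :> (H -> H) by apply/funext.
have {}e : S = T.
  case: S T e {cS cT h} => [S [[hS1] [hS2]]] [T [[hT1] [hT2]]] /= e.
  subst T.
  by rewrite (Prop_irrelevance hS1 hT1) (Prop_irrelevance hS2 hT2).
by subst T; rewrite (Prop_irrelevance cS cT).
Qed.

Lemma bcomp_cont S T : continuous (S \o T).
Proof. by move=> x; apply: continuous_comp; exact: bop_cont. Qed.

Definition bcomp S T : bop H := Bop (@bcomp_cont S T).

Lemma adjoint_sym S T : is_adjoint S T -> is_adjoint T S.
Proof. by move=> h x y; rewrite hdotC -h -hdotC. Qed.

Lemma adjoint_comp S T U V : is_adjoint S U -> is_adjoint T V ->
  is_adjoint (bcomp S T) (bcomp V U).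
Proof. by move=> h1 h2 x y /=; rewrite h1 h2. Qed.

Lemma adjoint_unique S T U : is_adjoint S T -> is_adjoint S U -> T = U.
Proof.
by move=> h1 h2; apply: bop_ext => x; apply: hdot_injr => y; rewrite -h1 -h2.
Qed.

Lemma normH_eq x y : '[x, x] = '[y, y] -> `|x| = `|y|.
Proof.
by rewrite -!hdotE => /eqP; rewrite eqrXn2 // => /eqP.
Qed.

Lemma normH_le x y : '[x, x] <= '[y, y] -> `|x| <= `|y|.
Proof. by rewrite -!hdotE ler_pXn2r // nnegrE. Qed.

Lemma projection_le (P : bop H) x : is_projection P -> `|P x| <= `|x|.
Proof.
move=> [PP aP]; apply: normH_le.
have -> : '[x, x] = '[P x, P x] + '[x - P x, x - P x].
  have e : '[P x, x - P x] = 0 by rewrite aP linearB /= PP subrr linear0r.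
  rewrite -{1 2}[x](subrK (P x)) [X in hdot H X X]addrC dnormD e conjC0 !addr0.
  by [].
by rewrite lerDl.
Qed.

Lemma bop_bound_cont (T : {linear H -> H}) (M : C) : 0 <= M ->
  (forall x, `|T x| <= M * `|x|) -> continuous T.
Proof.
move=> M0 h; apply: bounded_linear_continuous; apply/linear_boundedP.
near=> k => x; apply: (le_trans (h x)); apply: ler_wpM2r => //.
near: k; apply: nbhs_pinfty_ge; exact: ger0_real.
Unshelve. all: by end_near. Qed.

End Operators.

Section Semigroup.
Variable E : digraph.
Implicit Types (a b c d m : finpath E) (e : edge E) (v : vertex E).

Lemma vpath_cat a : pcat (vpath (psrc a)) a = a.
Proof. by apply: finpath_inj; rewrite ?psrc_cat// pedges_cat. Qed.

Lemma finpath_ind (P : finpath E -> Prop) :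
  (forall v, P (vpath v)) ->
  (forall e m, etgt e = psrc m -> P m -> P (pcat (epath e) m)) ->
  forall a, P a.
Proof.
move=> Pv Pe a; move en : (plen a) => n; elim: n a en => [|n IH] a an.
  suff -> : a = vpath (psrc a) by [].
  by apply: finpath_inj => //; apply: size0nil.
have [|e [m [_ em aE]]] := @finpath_cons _ a; first by rewrite an.
rewrite aE; apply: Pe => //; apply: IH.
by move: an; rewrite aE plen_cat// add1n => -[].
Qed.

Variant smul_spec a b c d : gis E -> Prop :=
| SmulL m of ptgt c = psrc m & b = pcat c m :
    smul_spec a b c d (spp a (pcat d m))
| SmulR m of ptgt b = psrc m & c = pcat b m :
    smul_spec a b c d (spp (pcat a m) d)
| SmulO of ~~ is_prefix c b & ~~ is_prefix b c : smul_spec a b c d None.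

Lemma smulP a b c d : ptgt a = ptgt b -> ptgt c = ptgt d ->
  smul_spec a b c d (smul (spp a b) (spp c d)).
Proof.
move=> /eqP ab /eqP cd; rewrite (sppE ab) (sppE cd) /=.
case: ifPn => [/is_prefixP[m cm ->]|ncb].
  by rewrite pquot_cat//; exact: SmulL.
case: ifPn => [/is_prefixP[m bm ->]|nbc].
  by rewrite pquot_cat//; exact: SmulR.
exact: SmulO.
Qed.

Variant gis_spec : gis E -> Prop :=
| GisZero : gis_spec None
| GisPair a b of ptgt a = ptgt b : gis_spec (spp a b).

Lemma gisP (s : gis E) : gis_spec s.
Proof.
case: s => [[[a b] /= ab]|]; last exact: GisZero.
by rewrite -sppE; apply: GisPair; apply/eqP.
Qed.

Lemma sstar_spp a b : ptgt a = ptgt b -> sstar (spp a b) = spp b a.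
Proof. by move=> /eqP ab; rewrite (sppE ab). Qed.

Lemma smul_spp a b c : ptgt a = ptgt b -> ptgt b = ptgt c ->
  smul (spp a b) (spp b c) = spp a c.
Proof.
move=> ab bc; rewrite -[in X in smul X _](pcat_vpath b) smul_catl//.
by rewrite bc pcat_vpath.
Qed.

Lemma smul_vert v a b : psrc a = v -> ptgt a = ptgt b ->
  smul (spp (vpath v) (vpath v)) (spp a b) = spp a b.
Proof.
move=> <- ab; rewrite -[in X in smul _ (spp X _)](vpath_cat a) smul_catr//.
by rewrite vpath_cat.
Qed.

Lemma smul_none a b c d : ptgt a = ptgt b -> ptgt c = ptgt d ->
  ~~ is_prefix c b -> ~~ is_prefix b c -> smul (spp a b) (spp c d) = None.
Proof.
by move=> ab cd cb bc; apply: smul_zero => // m h e;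
  [move/negP: cb | move/negP: bc]; apply; apply/is_prefixP; exists m.
Qed.

Lemma vpath_prefix v w : is_prefix (vpath v) (vpath w) = (v == w).
Proof. by rewrite /is_prefix andbT. Qed.

Lemma epath_prefix e f : is_prefix (epath e) (epath f) = (e == f).
Proof.
rewrite /is_prefix /= andbT.
by apply/andP/eqP => [[_ /eqP//]|->].
Qed.

Lemma is_prefix_cons e f m d : etgt e = psrc m -> etgt f = psrc d ->
  is_prefix (pcat (epath e) m) (pcat (epath f) d) = (e == f) && is_prefix m d.
Proof.
move=> em fd; rewrite /is_prefix !psrc_cat// !pedges_cat//=.
have [ef|ef] := eqVneq e f; last by rewrite andbF.
by rewrite -em -fd ef !eqxx.
Qed.

End Semigroup.

(** * Representations of the graph and of its inverse semigroup *)

Section GraphGis.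
Variables (R : realType) (H : hilbertType R) (E : digraph).
Implicit Types (a b c d m : finpath E) (e f : edge E) (v w : vertex E).
Local Notation "''[' x , y ]" := (hdot H x y).

Section GisToGraph.
Variables (Pi : gis E -> bop H) (rPi : is_gis_rep Pi).

Lemma gis_mul s t x : Pi s (Pi t x) = Pi (smul s t) x.
Proof. by rewrite (sr_mul rPi). Qed.

Lemma gis_adj a b : ptgt a = ptgt b -> is_adjoint (Pi (spp a b)) (Pi (spp b a)).
Proof. by move=> ab; rewrite -(sstar_spp ab); exact: sr_star. Qed.

Lemma gis_diag a : is_projection (Pi (spp a a)).
Proof.
by split=> [x|]; [rewrite gis_mul smul_spp | exact: gis_adj].
Qed.

Lemma partial_isometryP (S Sa P : bop H) : is_adjoint S Sa -> is_projection P ->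
  (forall x, Sa (S x) = P x) -> (forall x, S (P x) = S x) ->
  is_partial_isometry S.
Proof.
move=> aS [PP aP] SS SP x kerS; apply: normH_eq.
have k : '[x, x - P x] = 0 by apply: kerS; rewrite linearB /= SP subrr.
rewrite aS SS; apply/esym/eqP; rewrite -subr_eq0; apply/eqP.
by rewrite -k linearB.
Qed.

Lemma gis_graph_rep :
  is_graph_rep (fun v => Pi (spp (vpath v) (vpath v)))
    (fun e => Pi (spp (epath e) (vpath (etgt e))))
    (fun e => Pi (spp (vpath (etgt e)) (epath e))).
Proof.
split=> //.
- by move=> v; exact: gis_diag.
- move=> v w vw x; rewrite gis_mul smul_none ?vpath_prefix//.
    exact: sr_zero.
  by rewrite eq_sym.
- move=> e; apply: partial_isometryP (gis_diag (vpath (etgt e))) _ _.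
  + exact: gis_adj.
  + by move=> x; rewrite gis_mul smul_spp.
  + by move=> x; rewrite gis_mul smul_spp.
- by move=> e; apply: gis_adj.
- move=> e f ef x; rewrite !gis_mul !smul_spp// smul_none ?epath_prefix//.
    exact: sr_zero.
  by rewrite eq_sym.
- by move=> e x; rewrite gis_mul smul_spp.
- move=> v fv x; apply/eqP; rewrite -subr_eq0; apply/eqP.
  rewrite -[RHS](sr_sum rPi fv x); congr (_ - _); apply: eq_fsbigr => e _.
  by rewrite gis_mul smul_spp.
- by move=> e x; rewrite !gis_mul smul_spp// smul_vert// smul_spp.
- move=> A A0 oA; have [x [Ax [s xE]]] := sr_nondeg rPi A0 oA.
  exists x; split => //.
  pose src (s : gis E) : option (vertex E) :=
    if s is Some p then Some (psrc (val p).1) else None.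
  exists (pmap (fun p => omap (fun v => (v, Pi p.1 p.2)) (src p.1)) s).
  rewrite xE {xE Ax}; elim: s => [|[s y] l IH]; first by rewrite !big_nil.
  rewrite big_cons IH; case: (gisP s) => [|a b ab] /=.
    by rewrite (sr_zero rPi) add0r.
  have /eqP ab' := ab; rewrite (sppE ab') /= big_cons /= -(sppE ab').
  by congr (_ + _); rewrite gis_mul smul_vert.
Qed.

End GisToGraph.

Lemma gis_rep_pair (Pi : gis E -> bop H) a b x : is_gis_rep Pi ->
  ptgt a = ptgt b ->
  Pi (spp a b) x = Pi (spp a (vpath (ptgt a))) (Pi (spp (vpath (ptgt b)) b) x).
Proof. by move=> rPi ab; rewrite gis_mul// -ab smul_spp. Qed.

Lemma gis_rep_eq (Pi Pi' : gis E -> bop H) : is_gis_rep Pi -> is_gis_rep Pi' ->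
  (forall v, Pi (spp (vpath v) (vpath v)) = Pi' (spp (vpath v) (vpath v))) ->
  (forall e, Pi (spp (epath e) (vpath (etgt e))) =
             Pi' (spp (epath e) (vpath (etgt e)))) ->
  Pi = Pi'.
Proof.
move=> r r' hv he.
have up a : Pi (spp a (vpath (ptgt a))) = Pi' (spp a (vpath (ptgt a))).
  elim/finpath_ind: a => [v|e m em IH]; first exact: hv.
  have -> : spp (pcat (epath e) m) (vpath (ptgt (pcat (epath e) m))) =
      smul (spp (epath e) (vpath (etgt e))) (spp m (vpath (ptgt m))).
    rewrite ptgt_cat// -[in X in smul _ (spp X _)](vpath_cat m).
    by rewrite -em smul_catr.
  by apply: bop_ext => x; rewrite (sr_mul r) (sr_mul r') he IH.
apply/funext => s; case: (gisP s) => [|a b ab].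
  by apply: bop_ext => x; rewrite (sr_zero r) (sr_zero r').
apply: bop_ext => x; rewrite [LHS]gis_rep_pair// [RHS]gis_rep_pair// up.
suff -> : Pi (spp (vpath (ptgt b)) b) = Pi' (spp (vpath (ptgt b)) b) by [].
apply: (@adjoint_unique _ _ (Pi (spp b (vpath (ptgt b))))).
  exact: gis_adj.
by rewrite up; exact: gis_adj.
Qed.

Section GraphToGis.
Variables (P : vertex E -> bop H) (S Sa : edge E -> bop H).
Hypothesis rPS : is_graph_rep P S Sa.

Let Pid v x : P v (P v x) = P v x.
Proof. by have [] := gr_proj rPS v. Qed.

Let Padj v : is_adjoint (P v) (P v).
Proof. by have [] := gr_proj rPS v. Qed.

Lemma graph_tgt e x : S e (P (etgt e) x) = S e x.
Proof.
apply/eqP; rewrite -subr_eq0 -linearB /= -(dnorm_eq0 (hdot H)).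
rewrite (gr_adj rPS) (gr_init rPS) linearB /= Pid subrr.
by rewrite linear0r.
Qed.

Lemma graph_src e x : P (esrc e) (S e x) = S e x.
Proof. by rewrite -graph_tgt -(gr_init rPS) (gr_range rPS). Qed.

Lemma graph_src_adj e x : Sa e (P (esrc e) x) = Sa e x.
Proof.
apply: hdot_injr => y.
by rewrite -(gr_adj rPS) -Padj graph_src (gr_adj rPS).
Qed.

Lemma graph_tgt_adj e x : P (etgt e) (Sa e x) = Sa e x.
Proof.
apply: hdot_injr => y.
by rewrite -Padj -(gr_adj rPS) graph_tgt (gr_adj rPS).
Qed.

Lemma graph_edge_orth e f x : e != f -> Sa e (S f x) = 0.
Proof.
move=> ef; rewrite -graph_tgt_adj -(gr_init rPS) -(graph_tgt f x).
by rewrite -(gr_init rPS f) (gr_range_orth rPS)// linear0.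
Qed.

Definition path_op a : bop H :=
  foldr (fun e T => bcomp (S e) T) (P (ptgt a)) (pedges a).
Definition path_adj a : bop H :=
  foldr (fun e T => bcomp T (Sa e)) (P (ptgt a)) (pedges a).

Lemma path_op_adj a : is_adjoint (path_op a) (path_adj a).
Proof.
rewrite /path_op /path_adj; elim: (pedges a) => [|e p IH] /=; first exact: Padj.
by apply: adjoint_comp IH; exact: (gr_adj rPS).
Qed.

Lemma path_op_cons e m x : etgt e = psrc m ->
  path_op (pcat (epath e) m) x = S e (path_op m x).
Proof. by move=> em; rewrite /path_op ptgt_cat// pedges_cat. Qed.

Lemma path_op_tgt a x : path_op a (P (ptgt a) x) = path_op a x.
Proof.
by rewrite /path_op; elim: (pedges a) => [|e p IH] //=; rewrite IH.
Qed.

Lemma path_op_src a x : P (psrc a) (path_op a x) = path_op a x.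
Proof.
elim/finpath_ind: a => [v|e m em IH]; first exact: Pid.
by rewrite path_op_cons// psrc_cat// graph_src.
Qed.

Lemma path_op_cat a m x : ptgt a = psrc m ->
  path_op (pcat a m) x = path_op a (path_op m x).
Proof.
elim/finpath_ind: a => [v vm|e a ea IH].
  by rewrite (_ : v = psrc m)// vpath_cat; exact/esym/path_op_src.
rewrite ptgt_cat// => am.
by rewrite pcatA// !path_op_cons ?psrc_cat// IH.
Qed.

Lemma path_adj_cat a m x : ptgt a = psrc m ->
  path_adj (pcat a m) x = path_adj m (path_adj a x).
Proof.
move=> am; apply: hdot_injr => y.
by rewrite -!path_op_adj path_op_cat.
Qed.

Lemma path_adj_op a x : path_adj a (path_op a x) = P (ptgt a) x.
Proof.
elim/finpath_ind: a => [v|e m em IH]; first exact: Pid.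
rewrite path_op_cons// /path_adj ptgt_cat// pedges_cat//= (gr_init rPS) em.
by rewrite path_op_src.
Qed.

Lemma path_adj_op_none b c x : ~~ is_prefix c b -> ~~ is_prefix b c ->
  path_adj b (path_op c x) = 0.
Proof.
elim/finpath_ind: b c x => [v|e m em IH] c x.
  move=> _; rewrite /is_prefix prefix0s andbT => vc.
  by rewrite -path_op_src; apply: (gr_orth rPS).
elim/finpath_ind: c => [v|f d fd _].
  rewrite /is_prefix prefix0s andbT psrc_cat// => ve _.
  rewrite /path_adj pedges_cat//= -graph_src_adj -/(path_adj _).
  by rewrite /path_op /= (gr_orth rPS) 1?eq_sym// !linear0.
rewrite path_op_cons// !is_prefix_cons// /path_adj ptgt_cat// pedges_cat//=.
rewrite -/(path_adj _) [f == e]eq_sym.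
have [ef|ef] := eqVneq e f; last by rewrite graph_edge_orth// linear0.
move=> /= dm md; rewrite -ef (gr_init rPS) em.
rewrite -em ef fd path_op_src; exact: IH.
Qed.

Lemma zero_cont : continuous (\0 : H -> H).
Proof. exact: cst_continuous. Qed.

Definition graph_gis (s : gis E) : bop H :=
  if s is Some p then bcomp (path_op (val p).1) (path_adj (val p).2)
  else Bop zero_cont.

Lemma graph_gisE a b x : ptgt a = ptgt b ->
  graph_gis (spp a b) x = path_op a (path_adj b x).
Proof. by move=> /eqP ab; rewrite (sppE ab). Qed.

Lemma graph_gis_vert v : graph_gis (spp (vpath v) (vpath v)) = P v.
Proof. by apply: bop_ext => x; rewrite graph_gisE//; exact: Pid. Qed.

Lemma graph_gis_edge e : graph_gis (spp (epath e) (vpath (etgt e))) = S e.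
Proof.
by apply: bop_ext => x; rewrite graph_gisE//= !graph_tgt.
Qed.

Lemma path_adj_tgt a x : P (ptgt a) (path_adj a x) = path_adj a x.
Proof.
by apply: hdot_injr => y; rewrite -Padj -!path_op_adj path_op_tgt.
Qed.

Lemma graph_gis_rep : is_gis_rep graph_gis.
Proof.
have adj a b : ptgt a = ptgt b ->
    is_adjoint (graph_gis (spp a b)) (graph_gis (spp b a)).
  move=> ab x y; rewrite !graph_gisE// path_op_adj.
  exact: (adjoint_sym (@path_op_adj b)).
split=> //.
- move=> s t x; case: (gisP s) => [|a b ab]; first by [].
  case: (gisP t) => [|c d cd].
    by rewrite [RHS]linear0; case: (spp a b).
  rewrite [in RHS]graph_gisE// [in RHS]graph_gisE//.
  case: (smulP ab cd) => [m cm bE|m bm cE|cb bc].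
  + rewrite graph_gisE ?ptgt_cat -?cd ?ab ?bE ?ptgt_cat//.
    by rewrite !path_adj_cat -?cd// path_adj_op cd path_adj_tgt.
  + rewrite graph_gisE ?ptgt_cat ?ab -?cd ?cE ?ptgt_cat//.
    by rewrite !path_op_cat ?ab// path_adj_op bm path_op_src.
  + by rewrite path_adj_op_none// linear0.
- move=> s; case: (gisP s) => [|a b ab].
    by move=> x y; rewrite linear0l linear0r.
  by rewrite sstar_spp//; exact: adj.
- move=> v fv x; rewrite graph_gis_vert (gr_sum rPS)//.
  apply/eqP; rewrite subr_eq0; apply/eqP/eq_fsbigr => e _.
  rewrite graph_gisE// /path_op /path_adj /=.
  by rewrite graph_tgt graph_tgt_adj.
- move=> A A0 oA; have [x [Ax [s xE]]] := gr_nondeg rPS A0 oA.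
  exists x; split=> //.
  exists [seq (spp (vpath p.1) (vpath p.1), p.2) | p <- s].
  by rewrite xE big_map; apply: eq_bigr => p _; rewrite graph_gis_vert.
Qed.

End GraphToGis.

Lemma gis_graph_bij : set_bij (@gis_reps R H E) (@graph_reps R H E)
  (fun Pi : gis E -> bop H =>
     ((fun v => Pi (spp (vpath v) (vpath v))),
      (fun e => Pi (spp (epath e) (vpath (etgt e)))))).
Proof.
split.
- by move=> Pi rPi; eexists; exact: gis_graph_rep.
- move=> Pi Pi' /set_mem r /set_mem r' [hv he]; apply: gis_rep_eq => // z.
    exact: (congr1 (@^~ z) hv).
  exact: (congr1 (@^~ z) he).
- move=> [P S] [Sa rPS]; exists (graph_gis P S Sa); first exact: graph_gis_rep.
  congr pair; apply/funext => z.
    exact: (graph_gis_vert rPS).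
  exact: (graph_gis_edge rPS).
Qed.

End GraphGis.

(** * Norm estimate for linear combinations *)

Lemma seq_argmax (T : eqType) (f : T -> nat) (l : seq T) d : d \in l ->
  exists2 m, m \in l & forall c, c \in l -> (f c <= f m)%N.
Proof.
elim: l d => [//|c [|d l] IH d' _].
  by exists c; rewrite ?mem_head// => d; rewrite inE => /eqP ->.
have [m ml mm] := IH d (mem_head _ _).
have [cm|mc] := leqP (f c) (f m).
  exists m; first by rewrite inE ml orbT.
  by move=> d''; rewrite inE => /predU1P[->//|/mm].
exists c; rewrite ?mem_head// => d''; rewrite inE => /predU1P[->//|/mm h].
exact: leq_trans h (ltnW mc).
Qed.

Section BoundaryPaths.
Variable E : digraph.
Implicit Types (a b c d m : finpath E) (e : edge E) (v : vertex E).
Implicit Types (u x : bpath E).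

Lemma bpath_exists v : no_sinks E -> exists x, xsrc x = v.
Proof.
move=> hE.
have /choice[next nextE] : forall e : edge E, exists f, esrc f = etgt e.
  by move=> e; have [f] := hE (etgt e); exists f.
have [e ev] := hE v.
have zh : `[< forall i, etgt (iter i next e) = esrc (iter i.+1 next e) >].
  by apply/asboolP => i; rewrite iterS nextE.
pose z : ipath E := exist (fun z => `[< forall i, etgt (z i) = esrc (z i.+1) >])
  (fun i => iter i next e) zh.
by exists (inr z).
Qed.

Definition unit_cyl b : set (bpath E) :=
  [set u | exists2 x, ptgt b = xsrc x & xcat b x = u].

Lemma unit_cyl_prefix c b : is_prefix c b -> unit_cyl b `<=` unit_cyl c.
Proof.
move=> /is_prefixP[m cm ->] _ [x + <-]; rewrite ptgt_cat// => mx.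
by exists (xcat m x); rewrite /= ?xsrc_cat// xcatA.
Qed.

Lemma unit_cyl_cmp b c u : unit_cyl b u -> unit_cyl c u ->
  (plen b <= plen c)%N -> is_prefix b c.
Proof.
move=> [x bx uE] cu bc.
have gh : `[< pathgroupoid_set (u, (plen b)%:Z - (plen b)%:Z, u) >].
  by apply/asboolP; exists b, b, x; rewrite uE.
pose g : pathgroupoid E := exist (fun g => `[< pathgroupoid_set g >]) _ gh.
have bg : cyl b b g by exists x; rewrite //= uE.
have cg : cyl c c g.
  by case: cu => y cy yu; exists y; rewrite //= -yu !subrr.
have [m [bm -> _]] := cyl_nested erefl erefl bg cg bc.
by apply/is_prefixP; exists m.
Qed.

End BoundaryPaths.

Section Projections.
Variables (R : realType) (H : hilbertType R) (E : digraph).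
Implicit Types (a b c d m : finpath E) (e : edge E) (v : vertex E).
Implicit Types (x y z : H) (bs cs : seq (finpath E)).
Local Notation C := R[i].
Local Notation "''[' x , y ]" := (hdot H x y).
Variables (Pi : gis E -> bop H).
Hypothesis (rPi : is_gis_rep Pi).

Local Notation pr b := (Pi (spp b b)).

Lemma pr_idem b x : pr b (pr b x) = pr b x.
Proof. by have [] := gis_diag rPi b. Qed.

Lemma pr_adj b x y : '[pr b x, y] = '[x, pr b y].
Proof. by have [_] := gis_diag rPi b. Qed.

Lemma gis_pr_tgt a b m x : ptgt a = ptgt b -> ptgt b = psrc m ->
  Pi (spp a b) (pr (pcat b m) x) = Pi (spp (pcat a m) (pcat b m)) x.
Proof. by move=> ab bm; rewrite gis_mul// smul_catr// ptgt_cat. Qed.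

Lemma gis_pr_src a b m x : ptgt a = ptgt b -> ptgt b = psrc m ->
  pr (pcat a m) (Pi (spp a b) x) = Pi (spp (pcat a m) (pcat b m)) x.
Proof. by move=> ab bm; rewrite gis_mul// smul_catl// ?ptgt_cat ?ab. Qed.

Lemma pr_prefix_l c b x : is_prefix c b -> pr c (pr b x) = pr b x.
Proof. by move=> /is_prefixP[m cm ->]; rewrite gis_pr_tgt. Qed.

Lemma pr_prefix_r c b x : is_prefix c b -> pr b (pr c x) = pr b x.
Proof. by move=> /is_prefixP[m cm ->]; rewrite gis_pr_src. Qed.

Lemma pr_none b c x : ~~ is_prefix c b -> ~~ is_prefix b c ->
  pr b (pr c x) = 0.
Proof. by move=> cb bc; rewrite gis_mul// smul_none// (sr_zero rPi). Qed.

Lemma prC b c x : pr b (pr c x) = pr c (pr b x).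
Proof.
have [cb|cb] := boolP (is_prefix c b).
  by rewrite (pr_prefix_l _ cb) (pr_prefix_r _ cb).
have [bc|bc] := boolP (is_prefix b c).
  by rewrite (pr_prefix_l _ bc) (pr_prefix_r _ bc).
by rewrite !pr_none.
Qed.

Lemma pr_cmp b c x : x != 0 -> pr b x = x -> pr c x = x ->
  is_prefix b c || is_prefix c b.
Proof.
move=> x0 bx cx; apply: contraNT x0; rewrite negb_or => /andP[bc cb].
by rewrite -bx -cx pr_none.
Qed.

Lemma pr_edge b x : pr b x = x -> x != 0 -> Vfin (ptgt b) ->
  exists2 e, ptgt b = esrc e & pr (pcat b (epath e)) x != 0.
Proof.
move=> bx x0 fb; apply: contrapT => ne; move/eqP: x0; apply.
have y0 : Pi (spp (vpath (ptgt b)) b) x = 0.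
  have := sr_sum rPi fb (Pi (spp (vpath (ptgt b)) b) x).
  rewrite gis_mul// smul_spp// => /eqP; rewrite subr_eq0 => /eqP ->.
  rewrite fsbig1// => e /= eb; rewrite gis_mul//.
  have -> : smul (spp (epath e) (epath e)) (spp (vpath (ptgt b)) b) =
      smul (spp (epath e) (pcat b (epath e)))
        (spp (pcat b (epath e)) (pcat b (epath e))).
    rewrite smul_spp ?ptgt_cat ?eb//.
    rewrite -{2}(vpath_cat (epath e)) (_ : psrc (epath e) = ptgt b)//.
    by rewrite smul_catl.
  rewrite (sr_mul rPi).
  have [->|nz] := eqVneq (pr (pcat b (epath e)) x) 0; first by rewrite linear0.
  by case: ne; exists e.
by rewrite -bx -(@smul_spp _ b (vpath (ptgt b)) b)// (sr_mul rPi) y0 linear0.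
Qed.

(* The required point is found by following x down the tree of paths: at a
   finite emitter the relation sr_sum gives an edge e with pr (b e) x nonzero,
   and a path ending at an infinite emitter is itself a point of X. *)
Lemma pr_realize (hE : no_sinks E) b cs x : pr b x = x -> x != 0 ->
  (forall c, c \in cs -> pr c x = 0) ->
  exists2 u, unit_cyl b u & forall c, c \in cs -> ~ unit_cyl c u.
Proof.
have nbc c b' y : pr b' y = y -> y != 0 -> pr c y = 0 -> ~~ is_prefix c b'.
  move=> by_ y0 c0; apply: contraNN y0 => cb.
  by rewrite -by_ -(pr_prefix_l _ cb) by_ c0.
have : exists n, forall c, c \in cs -> (plen c <= plen b + n)%N.
  exists (\max_(c <- cs) plen c)%N => c cs_c.
  by rewrite (leq_trans _ (leq_addl _ _))// leq_bigmax_seq.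
case=> n; elim: n b x => [|n IH] b x le_n bx x0 csx.
  have [w bw] := bpath_exists (ptgt b) hE.
  have bu : unit_cyl b (xcat b w) by exists w.
  exists (xcat b w) => // c cc cu; have /negP := nbc _ _ _ bx x0 (csx c cc).
  by apply; apply: (unit_cyl_cmp cu bu); rewrite -[plen b]addn0 le_n.
have [fb|ib] := pselect (Vfin (ptgt b)).
  have [e be ex] := pr_edge bx x0 fb.
  have [||//|c cc|u bu cu] := IH (pcat b (epath e)) (pr (pcat b (epath e)) x).
  - by move=> c cc; rewrite plen_cat// -addnA; exact: le_n.
  - exact: pr_idem.
  - by rewrite prC csx// linear0.
  exists u => //; apply: unit_cyl_prefix bu.
  by apply/is_prefixP; exists (epath e).
have vi : `[< Vinf (ptgt (vpath (ptgt b))) >] by apply/asboolP.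
pose w : bpath E := inl (exist (fun p => `[< Vinf (ptgt p) >]) _ vi).
have bw : ptgt b = xsrc w by [].
have bu : unit_cyl b (xcat b w) by exists w.
exists (xcat b w) => // c cc cu; have /negP := nbc _ _ _ bx x0 (csx c cc).
apply; apply: (unit_cyl_cmp cu bu); rewrite leqNgt; apply/negP => bc.
case: cu => y cy yE; have := congr1 (fun t : bpath E => xnth t (plen b)) yE.
rewrite (xnth_cat _ cy) (xnth_cat _ bw) bc ltnn subnn /= => cn.
by move: bc; rewrite /plen -onthTE -/(plen b) cn.
Qed.

(* Splitting x as pr b x + (x - pr b x) for every b in bs reduces a claim to
   vectors decided by bs, without enumerating the atoms of the Boolean algebra
   generated by the commuting projections pr b. *)
Definition decided bs x := forall b, b \in bs -> pr b x = x \/ pr b x = 0.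

Lemma decide_ind bs (Q : H -> Prop) :
  (forall b x, b \in bs -> Q (pr b x) -> Q (x - pr b x) -> Q x) ->
  (forall x, decided bs x -> Q x) -> forall x, Q x.
Proof.
elim: bs => [|b bs IH] Qpr Qdec x; first exact: Qdec.
apply: IH => [c y cbs|y dx]; first by apply: Qpr; rewrite inE cbs orbT.
apply: (Qpr b); rewrite ?mem_head//; apply: Qdec => c.
  rewrite inE => /predU1P[->|/dx[cx|cx]]; first by left; rewrite pr_idem.
    by left; rewrite prC cx.
  by right; rewrite prC cx linear0.
rewrite inE linearB /= => /predU1P[->|/dx[cx|cx]].
  by right; rewrite pr_idem subrr.
  by left; rewrite prC cx.
by right; rewrite prC cx linear0 subr0.
Qed.

Lemma decided_point (hE : no_sinks E) bs x b : decided bs x -> x != 0 ->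
  b \in bs -> pr b x = x ->
  exists u, forall c, c \in bs -> unit_cyl c u <-> pr c x = x.
Proof.
move=> dx x0 bbs bx.
pose yes := [seq c <- bs | pr c x == x].
have byes : b \in yes by rewrite mem_filter bx eqxx.
have [m myes mmax] := seq_argmax (@plen E) byes.
have /andP[/eqP mx mbs] : (pr m x == x) && (m \in bs).
  by rewrite mem_filter in myes.
have [|u mu nu] := @pr_realize hE m [seq c <- bs | pr c x == 0] x mx x0.
  by move=> c; rewrite mem_filter => /andP[/eqP].
exists u => c cbs; split=> [cu|cx].
  case: (dx c cbs) => // c0; exfalso; apply: (nu c) cu.
  by rewrite mem_filter c0 eqxx.
apply: unit_cyl_prefix mu.
have cm : (plen c <= plen m)%N by apply: mmax; rewrite mem_filter cx eqxx.
case/orP: (pr_cmp x0 cx mx) => // /is_prefixP[d md cE].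
have : plen d = 0%N.
  by move: cm; rewrite cE plen_cat// -[leqRHS]addn0 leq_add2l leqn0 => /eqP.
move=> /size0nil d0; suff -> : c = m.
  by apply/is_prefixP; exists (vpath (ptgt m)); rewrite ?pcat_vpath.
by apply: finpath_inj; rewrite cE ?psrc_cat// pedges_cat// d0 cats0.
Qed.

End Projections.

Section CutDown.
Variables (R : realType) (H : hilbertType R) (E : digraph).
Implicit Types (a b c d m : finpath E).
Implicit Types (x y z : H) (bs cs : seq (finpath E)).
Local Notation C := R[i].
Local Notation "''[' x , y ]" := (hdot H x y).

Lemma hdot_le_normD x y : `|'[x, y]| *+ 2 <= `|x| ^+ 2 + `|y| ^+ 2.
Proof.
have [->|n0] := eqVneq '[x, y] 0.
  by rewrite normr0 mul0rn addr_ge0// exprn_ge0.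
pose l : C := '[x, y] / `|'[x, y]|.
have l1 : `|l| = 1.
  by rewrite normrM normfV normr_id divff// normr_eq0.
have xly : '[x, l *: y] = `|'[x, y]|.
  rewrite linearZr_LR /= /l rmorphM /= fmorphV /= conj_normC.
  by rewrite mulrAC [_^* * _]mulrC -normCK expr2 mulfK// normr_eq0.
rewrite -subr_ge0 !hdotE.
have := dnorm_ge0 (hdot H) (x - l *: y).
by rewrite dnormB xly dnormZ l1 expr1n mul1r conj_normC mulr2n.
Qed.

Variables (Pi : gis E -> bop H).
Hypothesis (rPi : is_gis_rep Pi).
Local Notation pr b := (Pi (spp b b)).

(* The operator counterpart of unit_cyl b minus the sets unit_cyl c. *)
Fixpoint cut b cs x : H :=
  if cs is c :: cs' then cut b cs' x - pr c (cut b cs' x) else pr b x.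

Lemma cutD b cs x y : cut b cs (x + y) = cut b cs x + cut b cs y.
Proof.
elim: cs => [|c cs IH] /=; first by rewrite linearD.
by rewrite IH linearD /= opprD addrACA.
Qed.

Lemma cut_pr d b cs x : cut b cs (pr d x) = pr d (cut b cs x).
Proof.
elim: cs => [|c cs IH] /=; first by rewrite prC.
by rewrite IH linearB /= (prC rPi c).
Qed.

Lemma cut0 b cs : cut b cs 0 = 0.
Proof.
by elim: cs => [|c cs IH] /=; [exact: linear0 | rewrite IH linear0 subr0].
Qed.

Lemma cutB b cs x y : cut b cs (x - y) = cut b cs x - cut b cs y.
Proof. by apply/eqP; rewrite eq_sym subr_eq -cutD subrK. Qed.

Lemma cut_adj b cs x y : '[cut b cs x, y] = '[x, cut b cs y].
Proof.
elim: cs x y => [|c cs IH] x y /=; first exact: pr_adj.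
by rewrite linearBl linearBr /= (pr_adj rPi) !IH cut_pr.
Qed.

Lemma cut_idem b cs x : cut b cs (cut b cs x) = cut b cs x.
Proof.
elim: cs => [|c cs IH] /=; first exact: pr_idem.
rewrite cutB cut_pr IH.
by rewrite !linearB /= (pr_idem rPi) subrr addr0.
Qed.

Lemma cut_keep b cs x : pr b x = x -> (forall c, c \in cs -> pr c x = 0) ->
  cut b cs x = x.
Proof.
move=> bx; elim: cs => [//|c cs IH] h /=.
rewrite IH ?h ?mem_head ?subr0// => d dcs; apply: h.
by rewrite inE dcs orbT.
Qed.

Lemma cut_kill b cs c x : c \in cs -> pr c x = x -> cut b cs x = 0.
Proof.
move=> + cx; elim: cs => [//|d cs IH].
rewrite inE /= => /predU1P[<-|/IH ->]; last by rewrite linear0 subr0.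
by rewrite -cut_pr cx subrr.
Qed.

Lemma cut_out b cs x : pr b x = 0 -> cut b cs x = 0.
Proof. by move=> b0; elim: cs => [//|c cs IH] /=; rewrite IH linear0 subr0. Qed.

Lemma normH_pr_split b x : `|x| ^+ 2 = `|pr b x| ^+ 2 + `|x - pr b x| ^+ 2.
Proof.
rewrite !hdotE -[in LHS](subrK (pr b x) x) [x - _ + _]addrC.
rewrite dnormD (_ : '[pr b x, x - pr b x] = 0) ?conjC0 ?addr0//.
by rewrite (pr_adj rPi) linearB /= (pr_idem rPi) subrr linear0r.
Qed.

Lemma cut_schur (hE : no_sinks E) (I : eqType) (F : seq I)
    (b : I -> finpath E) (cs : I -> seq (finpath E)) (d : I -> C) (M : C) :
  0 <= M ->
  (forall u, \sum_(i <- F | `[< unit_cyl (b i) u /\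
      forall c, c \in cs i -> ~ unit_cyl c u >]) d i <= M) ->
  forall x, \sum_(i <- F) d i * `|cut (b i) (cs i) x| ^+ 2 <= M * `|x| ^+ 2.
Proof.
move=> M0 hM.
pose bs := map b F ++ flatten (map cs F).
apply: (decide_ind rPi (bs := bs)).
  move=> c x _ h1 h2; rewrite (normH_pr_split c x) mulrDr.
  apply: le_trans (lerD h1 h2); rewrite -big_split /=.
  apply: ler_sum => i _; rewrite -mulrDr.
  by rewrite (normH_pr_split c (cut _ _ x)) cutB cut_pr.
move=> x dx; have [->|x0] := eqVneq x 0.
  rewrite normr0 expr0n mulr0 big1// => i _.
  by rewrite cut0 normr0 expr0n mulr0.
have [[i0 i0F bx]|nb] :=
  pselect (exists2 i, i \in F & pr (b i) x = x); last first.
  rewrite big_seq big1 ?mulr_ge0 ?exprn_ge0// => i iF.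
  rewrite cut_out ?normr0 ?expr0n ?mulr0//.
  have [|bx|//] := dx (b i); first by rewrite mem_cat map_f.
  by case: nb; exists i.
have ibs : b i0 \in bs by rewrite mem_cat map_f.
have [u uP] := decided_point rPi hE dx x0 ibs bx.
apply: le_trans (ler_wpM2r _ (hM u)); last by rewrite exprn_ge0.
rewrite mulr_suml [leRHS]big_mkcond /= big_seq [leRHS]big_seq.
apply: ler_sum => i iF.
have bi : b i \in bs by rewrite mem_cat map_f.
have csi c : c \in cs i -> c \in bs.
  move=> ci; rewrite mem_cat; apply/orP; right; apply/flattenP.
  by exists (cs i) => //; apply: map_f.
case: asboolP => [[bu cu]|nu].
  rewrite cut_keep//; first exact/uP.
  move=> c ci; have [|cx|//] := dx c; first exact: csi.
  by case: (cu c ci); apply/uP => //; exact: csi.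
suff -> : cut (b i) (cs i) x = 0 by rewrite normr0 expr0n mulr0.
have [//|bix|] := dx (b i); last exact: cut_out.
have [[c ci cx]|nc] := pselect (exists2 c, c \in cs i & pr c x = x).
  exact: cut_kill ci cx.
case: nu; split; first exact/uP.
by move=> c ci /uP cx; apply: nc; exists c => //; apply: cx; exact: csi.
Qed.

End CutDown.

Section Combinations.
Variables (R : realType) (E : digraph).
Local Notation C := R[i].
Local Notation G := (pathgroupoid E).
Local Notation pair := {p : finpath E * finpath E | ptgt p.1 == ptgt p.2}.
Implicit Types (f h : G -> C) (M : C) (L : seq (C * gis E)) (s t : pair).
Implicit Types (a b : finpath E).

(* The flag r selects the range (true) or the source (false). *)
Definition gend (r : bool) (g : G) : bpath E := if r then grng g else gsrc g.
Definition pend (r : bool) t : finpath E := if r then (val t).1 else (val t).2.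

(* I_bounded M f says that the I-norm of f is at most M (see I_normP), without
   extended real numbers. *)
Definition I_bounded M f := forall r u (D : seq G), uniq D ->
  (forall g, g \in D -> gend r g = u) -> \sum_(g <- D) `|f g| <= M.

Definition comb L : Cc R E := \sum_(p <- L) p.1 *: chi R p.2.

Lemma CcD (f h : Cc R E) g : (f + h) g = f g + h g. Proof. by []. Qed.
Lemma CcB (f h : Cc R E) g : (f - h) g = f g - h g. Proof. by []. Qed.
Lemma CcZ (c : C) (f : Cc R E) g : (c *: f) g = c * f g. Proof. by []. Qed.

Lemma Cc_ext (f h : Cc R E) : (forall g, f g = h g) -> f = h.
Proof. by move=> fh; apply: val_inj; apply/funext. Qed.

Lemma combE L g : comb L g = \sum_(p <- L) p.1 * chi R p.2 g.
Proof.
rewrite /comb; elim: L => [|p L IH]; first by rewrite !big_nil.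
by rewrite !big_cons CcD IH.
Qed.

Lemma spp_val t : spp (val t).1 (val t).2 = Some t.
Proof. by rewrite /spp -surjective_pairing valK. Qed.

Definition mkpair a b (ab : ptgt a = ptgt b) : pair :=
  exist (fun p => ptgt p.1 == ptgt p.2) (a, b) (introT eqP ab).

Lemma pair_tgt t : ptgt (val t).1 = ptgt (val t).2.
Proof. exact/eqP/(valP t). Qed.

Definition pair_cyl t : set G := cyl (val t).1 (val t).2.

Lemma chiE t g : chi R (Some t) g = (g \in pair_cyl t)%:R.
Proof. by rewrite /= indicE. Qed.

(* The natural partial order of the inverse semigroup. *)
Definition tle t s : Prop := exists m, [/\ ptgt (val s).1 = psrc m,
  (val t).1 = pcat (val s).1 m & (val t).2 = pcat (val s).2 m].

Lemma tle_refl t : tle t t.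
Proof.
exists (vpath (ptgt (val t).1)); split => //.
  by rewrite pcat_vpath.
by rewrite pair_tgt pcat_vpath.
Qed.

Lemma tle_trans s t (u : pair) : tle t s -> tle u t -> tle u s.
Proof.
move=> [m [sm t1 t2]] [n [tn u1 u2]].
have sm2 : ptgt (val s).2 = psrc m by rewrite -pair_tgt.
have mn : ptgt m = psrc n by rewrite -tn t1 ptgt_cat.
exists (pcat m n); split; first by rewrite psrc_cat.
  by rewrite u1 t1 pcatA.
by rewrite u2 t2 pcatA.
Qed.

Lemma tle_prefix r t s : tle t s -> is_prefix (pend r s) (pend r t).
Proof.
by move=> [m [sm t1 t2]]; apply/is_prefixP; exists m;
  case: r => //=; rewrite -pair_tgt.
Qed.

Lemma tle_plen_eq r t s : tle t s -> (plen (pend r t) <= plen (pend r s))%N ->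
  t = s.
Proof.
move=> [m [sm t1 t2]].
have sm2 : ptgt (val s).2 = psrc m by rewrite -pair_tgt.
have -> : plen (pend r t) = (plen (pend r s) + plen m)%N.
  by case: r; rewrite /= ?t1 ?t2 plen_cat.
rewrite -[X in (_ <= X)%N -> _]addn0 leq_add2l leqn0 => /nilP m0.
apply: val_inj; rewrite [LHS]surjective_pairing [RHS]surjective_pairing t1 t2.
congr (_, _);
  by apply: finpath_inj; rewrite ?psrc_cat ?pedges_cat// m0 cats0.
Qed.

Lemma tle_cmp t u s : tle t s -> tle u s ->
  is_prefix (pend false u) (pend false t) -> tle t u.
Proof.
move=> [m [sm t1 t2]] [n [sn u1 u2]] /is_prefixP[k uk tk].
have sm2 : ptgt (val s).2 = psrc m by rewrite -pair_tgt.
have sn2 : ptgt (val s).2 = psrc n by rewrite -pair_tgt.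
have nk : ptgt n = psrc k by rewrite -uk /= u2 ptgt_cat.
have mE : m = pcat n k.
  apply: (@pcat_injr _ (val s).2); rewrite ?psrc_cat//.
  by rewrite -t2 -pcatA// -u2.
exists k; split; first by rewrite pair_tgt.
  by rewrite t1 u1 mE pcatA.
by rewrite t2 u2 mE pcatA.
Qed.

Lemma pair_cyl_le t s : tle t s -> pair_cyl t `<=` pair_cyl s.
Proof.
move=> [m [sm t1 t2]]; rewrite /pair_cyl t1 t2.
exact: (cyl_cat (pair_tgt s)).
Qed.

Lemma pair_cyl_total t s g : pair_cyl t g -> pair_cyl s g -> tle t s \/ tle s t.
Proof.
move=> tg sg; have [st|/ltnW ts] := leqP (plen (val s).1) (plen (val t).1).
  by left; exact: (cyl_nested (pair_tgt s) (pair_tgt t) sg tg st).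
by right; exact: (cyl_nested (pair_tgt t) (pair_tgt s) tg sg ts).
Qed.

Lemma unit_cyl_gend r t g : pair_cyl t g -> unit_cyl (pend r t) (gend r g).
Proof.
move=> [x tx gE]; exists x; first by case: r; rewrite //= pair_tgt.
by case: r; rewrite /gend /grng /gsrc gE.
Qed.

Lemma pair_cyl_elt t x : ptgt (val t).2 = xsrc x -> exists g : G,
  val g = (xcat (val t).1 x, (plen (val t).1)%:Z - (plen (val t).2)%:Z,
           xcat (val t).2 x).
Proof.
move=> tx; have gh : `[< pathgroupoid_set (xcat (val t).1 x,
    (plen (val t).1)%:Z - (plen (val t).2)%:Z, xcat (val t).2 x) >].
  by apply/asboolP; exists (val t).1, (val t).2, x; rewrite pair_tgt.
by exists (exist (fun g => `[< pathgroupoid_set g >]) _ gh).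
Qed.

Lemma gend_lift r t u : unit_cyl (pend r t) u ->
  exists2 g, pair_cyl t g & gend r g = u.
Proof.
move=> [x + xE]; have -> : ptgt (pend r t) = ptgt (val t).2.
  by case: (r); rewrite /= ?pair_tgt.
move=> tx; have [g gE] := pair_cyl_elt tx; exists g; first by exists x.
by rewrite -xE; case: (r); rewrite /gend /grng /gsrc gE.
Qed.

Definition below r (F : seq pair) t : seq (finpath E) :=
  [seq pend r u | u <- F & `[< tle u t >] && (u != t)].

(* For t in F these sets are disjoint and a combination of the indicators of the
   cylinders of F is constant on each of them. *)
Definition core (F : seq pair) t : set G :=
  [set g | pair_cyl t g /\
    forall u, u \in F -> tle u t -> u != t -> ~ pair_cyl u g].

Lemma core_disj F t s g : t \in F -> s \in F -> core F t g -> core F s g ->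
  t = s.
Proof.
move=> tF sF [tg tc] [sg sc]; have [//|ts] := eqVneq t s.
case: (pair_cyl_total tg sg) => h; first by case: (sc t tF h ts).
by case: (tc s sF h) => //; rewrite eq_sym.
Qed.

Lemma core_lift r F t u : unit_cyl (pend r t) u ->
  (forall c, c \in below r F t -> ~ unit_cyl c u) ->
  exists2 g, core F t g & gend r g = u.
Proof.
move=> /gend_lift[g tg gu] nu; exists g => //; split=> // s sF st s_t sg.
apply: (nu (pend r s)); last by rewrite -gu; exact: unit_cyl_gend.
by apply: map_f; rewrite mem_filter sF s_t !andbT; apply/asboolP.
Qed.

Lemma I_bounded_core (f : G -> C) M r (F : seq pair) (d : pair -> C) u :
  uniq F ->
  I_bounded M f -> (forall t g, t \in F -> core F t g -> f g = d t) ->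
  \sum_(t <- F | `[< unit_cyl (pend r t) u /\
      forall c, c \in below r F t -> ~ unit_cyl c u >]) `|d t| <= M.
Proof.
move=> uF bf fd; rewrite -big_filter.
set F' := [seq t <- F | _].
have F'P t : t \in F' -> t \in F /\ exists2 g, core F t g & gend r g = u.
  rewrite mem_filter => /andP[/asboolP[h1 h2] tF].
  by split=> //; exact: core_lift.
have uF' : uniq F' by rewrite filter_uniq.
clearbody F'.
case: F' => [|t0 F0] in F'P uF' *.
  by have := bf true u [::]; rewrite !big_nil; apply.
have [_ [g0 _ _]] := F'P t0 (mem_head _ _).
have /choice[k kP] : forall t, exists g,
    t \in t0 :: F0 -> core F t g /\ gend r g = u.
  move=> t; have [/F'P[_ [g h1 h2]]|] := boolP (t \in t0 :: F0).
    by exists g.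
  by exists g0.
have <- : \sum_(g <- map k (t0 :: F0)) `|f g| = \sum_(t <- t0 :: F0) `|d t|.
  rewrite big_map big_seq [RHS]big_seq; apply: eq_bigr => t tF.
  by rewrite (fd t)//; [have [] := F'P t tF|have [] := kP t tF].
apply: (bf r u).
  rewrite map_inj_in_uniq// => t s tF sF e.
  have [[ct _] [cs _]] := (kP t tF, kP s sF).
  apply: (core_disj (g := k t)) ct _; rewrite ?e//.
    by have [] := F'P t tF.
  by have [] := F'P s sF.
by move=> g /mapP[t tF ->]; have [] := kP t tF.
Qed.

End Combinations.

Section Bound.
Variables (R : realType) (H : hilbertType R) (E : digraph).
Local Notation C := R[i].
Local Notation G := (pathgroupoid E).
Local Notation pair := {p : finpath E * finpath E | ptgt p.1 == ptgt p.2}.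
Local Notation "''[' x , y ]" := (hdot H x y).
Implicit Types (M : C) (L : seq (C * gis E)) (s t u : pair) (F : seq pair).
Implicit Types (x y z : H).
Variables (Pi : gis E -> bop H).
Hypotheses (rPi : is_gis_rep Pi) (hE : no_sinks E).
Local Notation pr b := (Pi (spp b b)).

Definition lincomb L x : H := \sum_(p <- L) p.1 *: Pi p.2 x.

Lemma pair_pr t s x : tle t s ->
  Pi (Some s) (pr (pend false t) x) = pr (pend true t) (Pi (Some s) x).
Proof.
move=> [m [sm t1 t2]]; rewrite -(spp_val s) /pend t1 t2.
by rewrite gis_pr_tgt ?gis_pr_src -?pair_tgt//; exact: pair_tgt.
Qed.

Lemma pair_le_pr t s x : tle t s ->
  Pi (Some s) (pr (pend false t) x) = Pi (Some t) x.
Proof.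
move=> [m [sm t1 t2]]; rewrite -(spp_val s) -(spp_val t) /pend t1 t2.
by rewrite gis_pr_tgt -?pair_tgt//; exact: pair_tgt.
Qed.

Definition cutp r F t x := cut Pi (pend r t) (below r F t) x.

Lemma pair_cut F t x :
  Pi (Some t) (cutp false F t x) = cutp true F t (Pi (Some t) x).
Proof.
rewrite /cutp /below; elim: F => [|u F IH] /=.
  exact: pair_pr (tle_refl t).
case: ifPn => [/andP[/asboolP ut _]|//].
by rewrite /= linearB /= IH pair_pr// IH.
Qed.

Lemma pair_vert t x : Pi (Some t) (pr (pend false t) x) = Pi (Some t) x.
Proof. by rewrite -spp_val gis_mul// smul_spp// pair_tgt. Qed.

Lemma pair_contract t x : `|Pi (Some t) x| <= `|x|.
Proof.
apply: le_trans (projection_le x (gis_diag rPi (pend false t))).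
apply: normH_le.
rewrite -spp_val (gis_adj rPi (pair_tgt t)) gis_mul//.
by rewrite smul_spp ?pair_tgt//= -[X in '[_, X]](pr_idem rPi) -pr_adj.
Qed.

Lemma pair_cut_sum F s x : uniq F -> s \in F ->
  Pi (Some s) x = \sum_(t <- F | `[< tle t s >]) Pi (Some t) (cutp false F t x).
Proof.
move=> uF sF; move: x.
apply: (decide_ind rPi (bs := [seq pend false t | t <- F])).
  move=> b x _ h1 h2.
  rewrite -{1}[x](subrK (pr b x)) linearD /= h1 h2 -big_split.
  by apply: eq_bigr => t _ /=; rewrite -linearD -cutD// subrK.
move=> x dx; have dF t : t \in F ->
    pr (pend false t) x = x \/ pr (pend false t) x = 0.
  by move=> tF; apply: dx; apply: map_f.
have [->|x0] := eqVneq x 0.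
  by rewrite linear0 big1// => t _; rewrite /cutp cut0// linear0.
have [sx|sx] := dF s sF; last first.
  rewrite -pair_vert sx linear0 big1// => t /asboolP ts.
  rewrite /cutp cut_out ?linear0//.
  by rewrite -(pr_prefix_r rPi x (tle_prefix false ts)) sx linear0.
pose A := [seq t <- F | `[< tle t s >] && (pr (pend false t) x == x)].
have [|t] := @seq_argmax _ (fun u => plen (pend false u)) A s.
  by rewrite mem_filter sF sx eqxx !andbT; apply/asboolP; exact: tle_refl.
rewrite mem_filter => /andP[/andP[/asboolP ts /eqP tx] tF] tmax.
have tkeep : cutp false F t x = x.
  apply: cut_keep => // c /mapP[u]; rewrite mem_filter.
  move=> /andP[/andP[/asboolP ut u_t] uF'] ->.
  case: (dF u uF') => // ux; case/eqP: u_t.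
  apply: (tle_plen_eq (r := false) ut); apply: tmax.
  rewrite mem_filter uF' ux eqxx !andbT; apply/asboolP; exact: tle_trans ut.
rewrite -big_filter (bigD1_seq t) ?filter_uniq//=; last first.
  by rewrite mem_filter tF andbT; apply/asboolP.
rewrite tkeep big_seq_cond big1 ?addr0 -?(pair_le_pr _ ts) ?tx// => u.
rewrite mem_filter => /andP[/andP[/asboolP us uF'] ut].
suff -> : cutp false F u x = 0 by rewrite linear0.
have [ux|] := dF u uF'; last exact: cut_out.
have ple : (plen (pend false u) <= plen (pend false t))%N.
  apply: tmax; rewrite mem_filter uF' ux eqxx !andbT; exact/asboolP.
case/orP: (pr_cmp rPi x0 ux tx) => [h|h]; last first.
  by case/eqP: ut; apply: tle_plen_eq ple; exact: tle_cmp us ts h.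
apply: (@cut_kill _ _ _ _ rPi _ _ (pend false t)) => //; apply: map_f.
rewrite mem_filter tF eq_sym ut !andbT; apply/asboolP; exact: tle_cmp ts us h.
Qed.

Section Coefficients.
Variable L : seq (C * gis E).

Let supp : seq pair := undup (pmap id [seq p.2 | p <- L]).
Let coef t : C :=
  \sum_(p <- L | if p.2 is Some s then `[< tle t s >] else false) p.1.

Let suppP s c : (c, Some s) \in L -> s \in supp.
Proof.
move=> h; rewrite mem_undup mem_pmap; apply/mapP; exists (Some s) => //.
by apply/mapP; exists (c, Some s).
Qed.

Lemma lincomb_core x : lincomb L x =
  \sum_(t <- supp) coef t *: Pi (Some t) (cutp false supp t x).
Proof.
under [RHS]eq_bigr do rewrite scaler_suml.
rewrite (exchange_big_dep predT)//= /lincomb big_seq [RHS]big_seq.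
apply: eq_bigr => -[c [s|]] /= pL; last first.
  by rewrite (sr_zero rPi) scaler0 big_pred0.
by rewrite (@pair_cut_sum supp s) ?undup_uniq ?(suppP pL)// scaler_sumr.
Qed.

Lemma comb_core t g : t \in supp -> core supp t g -> comb L g = coef t.
Proof.
move=> tF [tg nt]; rewrite combE /coef [RHS]big_mkcond big_seq [RHS]big_seq.
apply: eq_bigr => -[c [s|]] pL; last exact: mulr0.
rewrite chiE /=; case: asboolP => [ts|nts].
  by rewrite mem_set ?mulr1//; exact: pair_cyl_le tg.
rewrite memNset ?mulr0// => sg.
have [//|st] := pair_cyl_total tg sg.
apply: (nt s (suppP pL) st) => //; apply: contra_not_neq nts => ->.
exact: tle_refl.
Qed.

Lemma lincomb_bound M x : 0 <= M -> I_bounded M (comb L) ->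
  `|lincomb L x| <= M * `|x|.
Proof.
move=> M0 bL.
have schur r z : \sum_(t <- supp) `|coef t| * `|cutp r supp t z| ^+ 2 <=
    M * `|z| ^+ 2.
  apply: (cut_schur rPi hE) => // u; apply: I_bounded_core bL _.
    exact: undup_uniq.
  exact: comb_core.
(* Schur test: AM-GM on each term, the two resulting weighted sums being
   estimated on the source and on the range side. *)
have dot_le y : `|'[lincomb L x, y]| *+ 2 <= M * (`|x| ^+ 2 + `|y| ^+ 2).
  rewrite mulrDr; apply: le_trans (lerD (schur false x) (schur true y)).
  rewrite -big_split lincomb_core linear_sumlz /=.
  rewrite -mulr_natr; apply: (@le_trans _ _ ((\sum_(t <- supp) `|coef t| *
      `|'[Pi (Some t) (cutp false supp t x), cutp true supp t y]|) * 2%:R)).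
    apply: ler_wpM2r => //; apply: le_trans (ler_norm_sum _ _ _) _.
    apply: ler_sum => t _; rewrite linearZl_LR /= normrM.
    rewrite {1}/cutp -[cut _ _ _ x](cut_idem rPi) -/(cutp false supp t _).
    by rewrite pair_cut /cutp (cut_adj rPi).
  rewrite mulr_suml; apply: ler_sum => t _.
  rewrite -mulrA mulr_natr -mulrDr; apply: ler_wpM2l => //.
  apply: le_trans (hdot_le_normD _ _) _; rewrite lerD2r.
  by rewrite lerXn2r ?nnegrE// pair_contract.
have [M_0|Mn0] := eqVneq M 0.
  have := dot_le (lincomb L x); rewrite M_0 !mul0r -hdotE normrX normr_id.
  rewrite pmulrn_lle0// => h.
  have : `|lincomb L x| ^+ 2 == 0 by rewrite eq_le h exprn_ge0.
  by rewrite sqrf_eq0 => /eqP ->.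
have Mi z : M * (M^-1 ^+ 2 * `|z : H| ^+ 2) = M^-1 * `|z| ^+ 2.
  by rewrite expr2 !mulrA divff// mul1r.
have := dot_le (M^-1 *: lincomb L x).
rewrite linearZr_LR /= -hdotE normrM normrZ normrX normr_id norm_conjC.
rewrite (ger0_norm (x := M^-1)) ?invr_ge0// exprMn mulrDr Mi mulr2n lerD2r.
rewrite -(ler_pM2l (x := M)) ?lt0r ?Mn0// mulrA divff// mul1r mulrA -expr2.
by rewrite -exprMn ler_pXn2r // nnegrE ?mulr_ge0.
Qed.

End Coefficients.

End Bound.

(** * Approximation in the I-norm and convolution *)

Section BoundAlgebra.
Variables (R : realType) (E : digraph).
Local Notation C := R[i].
Local Notation G := (pathgroupoid E).
Local Notation pair := {p : finpath E * finpath E | ptgt p.1 == ptgt p.2}.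
Implicit Types (f h : G -> C) (M : C) (L : seq (C * gis E)) (s t : pair).

Lemma eq_I_bounded M f h : f =1 h -> I_bounded M f -> I_bounded M h.
Proof. by move=> fh; rewrite (funext fh). Qed.

Lemma I_bounded_le M M' f : M <= M' -> I_bounded M f -> I_bounded M' f.
Proof. by move=> MM bf r u D uD Du; apply: le_trans MM; exact: bf uD Du. Qed.

Lemma I_bounded_norm M f h : (forall g, `|f g| <= `|h g|) ->
  I_bounded M h -> I_bounded M f.
Proof.
move=> fh bh r u D uD Du; apply: le_trans (bh r u D uD Du).
exact: ler_sum.
Qed.

Lemma I_boundedD M M' f h : I_bounded M f -> I_bounded M' h ->
  I_bounded (M + M') (fun g => f g + h g).
Proof.
move=> bf bh r u D uD Du.
apply: le_trans (lerD (bf _ _ _ uD Du) (bh _ _ _ uD Du)).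
by rewrite -big_split; apply: ler_sum => g _; exact: ler_normD.
Qed.

Lemma I_boundedZ M c f : I_bounded M f ->
  I_bounded (`|c| * M) (fun g => c * f g).
Proof.
move=> bf r u D uD Du; apply: le_trans (ler_wpM2l _ (bf _ _ _ uD Du)) => //.
by rewrite mulr_sumr; apply: ler_sum => g _; rewrite normrM.
Qed.

Lemma I_boundedN M f : I_bounded M f -> I_bounded M (fun g => - f g).
Proof. by apply: I_bounded_norm => g; rewrite normrN. Qed.

Lemma I_bounded_ge0 M f : I_bounded M f -> bpath E -> 0 <= M.
Proof. by move=> bf u; have := bf true u [::]; rewrite big_nil; apply. Qed.

Lemma I_bounded_ginv M f : I_bounded M f ->
  I_bounded M (fun g => (f (ginv g))^*).
Proof.
move=> bf r u D uD Du.
rewrite (eq_bigr (fun g => `|f (ginv g)|)) => [|g _]; last exact: norm_conjC.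
rewrite -(big_map (@ginv E) predT (fun g => `|f g|)).
apply: (bf (~~ r) u).
  by rewrite map_inj_uniq//; exact: (can_inj (@ginvK E)).
by move=> g /mapP[k kD ->]; rewrite -(Du k kD); case: r {Du}.
Qed.

Lemma pair_cyl_inj r t g k : pair_cyl t g -> pair_cyl t k ->
  gend r g = gend r k -> g = k.
Proof.
move=> [x tx gE] [y ty kE].
have -> : gend r g = xcat (pend r t) x by case: r; rewrite /gend /grng /gsrc gE.
have -> : gend r k = xcat (pend r t) y by case: r; rewrite /gend /grng /gsrc kE.
have rt : ptgt (pend r t) = ptgt (val t).2 by case: r; rewrite /= ?pair_tgt.
move=> /xcat_injl xy; apply: val_inj; rewrite gE kE xy//.
  by rewrite rt.
by rewrite rt.
Qed.

Definition narrow (ts : seq pair) f := forall g, f g != 0 ->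
  exists2 t, t \in ts & pair_cyl t g.

Lemma I_bounded_narrow M ts f : 0 <= M -> (forall g, `|f g| <= M) ->
  narrow ts f -> I_bounded (M *+ size ts) f.
Proof.
move=> M0 fM nf r u D uD Du.
apply: (@le_trans _ _
    (\sum_(t <- ts) \sum_(g <- D) if g \in pair_cyl t then M else 0)).
  rewrite exchange_big /=; apply: ler_sum => g _.
  have [f0|/nf[t tts /mem_set tg]] := eqVneq (f g) 0.
    by rewrite f0 normr0; apply: sumr_ge0 => t _; case: ifP.
  rewrite (big_rem t)//= tg; apply: ler_wpDr => //.
  by apply: sumr_ge0 => s _; case: ifP.
rewrite -iter_addr_0 -[size ts]count_predT -big_const_seq.
apply: ler_sum => t _; rewrite -big_mkcond -big_filter.
set D' := [seq g <- D | _].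
have uD' : uniq D' by rewrite filter_uniq.
have D'P g : g \in D' -> pair_cyl t g /\ gend r g = u.
  by rewrite mem_filter => /andP[/set_mem tg /Du].
case: D' uD' D'P => [|g [|k D'']] uD' D'P; first by rewrite big_nil.
  by rewrite big_seq1.
have [tg gu] := D'P g (mem_head _ _).
have [|tk ku] := D'P k; first by rewrite !inE eqxx orbT.
by move: uD'; rewrite /= (pair_cyl_inj (r := r) tg tk) ?gu ?ku// mem_head.
Qed.

Lemma narrow_chi s : narrow [:: s] (chi R (Some s)).
Proof.
move=> g; rewrite chiE; case: (boolP (g \in _)) => [/set_mem sg _|_].
  by exists s; rewrite ?mem_head.
by rewrite eqxx.
Qed.

Lemma I_bounded_chi (s : gis E) : I_bounded 1 (chi R s).
Proof.
case: s => [s|]; last first.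
  by move=> r u D _ _; rewrite big1// => g _; exact: normr0.
rewrite -[1]/(1 *+ size [:: s]).
apply: I_bounded_narrow => //; last exact: narrow_chi.
by move=> g; rewrite chiE; case: (g \in _); rewrite ?normr1 ?normr0.
Qed.

Lemma I_bounded_comb L : exists2 M, 0 <= M & I_bounded M (comb L).
Proof.
elim: L => [|p L [M M0 bM]].
  exists 0 => // r u D _ _; rewrite big1// => g _.
  by rewrite combE big_nil normr0.
exists (`|p.1| * 1 + M); first by rewrite mulr1 addr_ge0.
apply: eq_I_bounded (I_boundedD (I_boundedZ p.1 (I_bounded_chi p.2)) bM) => g.
by rewrite !combE big_cons.
Qed.

Lemma I_normP (f : Cc R E) (M : R) : 0 <= M ->
  (I_norm f <= M%:E)%E <-> I_bounded M%:C%C f.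
Proof.
move=> M0.
have normcE g : `|f g| = (Normc.normc (f g))%:C%C by [].
have sumE D : \sum_(g <- D) `|f g| = (\sum_(g <- D) Normc.normc (f g))%:C%C.
  by rewrite raddf_sum.
split=> [fM r u D uD Du|fM].
  rewrite sumE lecR -lee_fin -sumEFin fsbig_seq//.
  apply: le_trans fM; rewrite /I_norm le_max; apply/orP.
  have ub (gend' : G -> bpath E) : (forall g, g \in D -> gend' g = u) ->
      (\sum_(g \in [set` D]) (Normc.normc (f g))%:E <= ereal_sup
       [set \esum_(g in [set g | gend' g = u]) (Normc.normc (f g))%:E
       | u in [set: bpath E]])%E.
    move=> Du'; apply: le_trans (ereal_sup_ubound _); last by exists u.
    apply: esum_ge; exists [set` D] => //.
    by split; [exact: finite_seq | move=> g; exact: Du'].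
  by case: r Du => Du; [left|right]; apply: ub.
rewrite /I_norm ge_max; apply/andP; split; apply: ge_ereal_sup => _ [u _ <-];
  apply: ge_ereal_sup => _ [A [finA Au] <-];
  rewrite fsbig_finite// sumEFin lee_fin -lecR -sumE.
  apply: (fM true u); first exact: finmap.fset_uniq.
  by move=> g; rewrite in_fset_set// => /set_mem /Au.
apply: (fM false u); first exact: finmap.fset_uniq.
by move=> g; rewrite in_fset_set// => /set_mem /Au.
Qed.

End BoundAlgebra.

Section Density.
Variables (R : realType) (E : digraph).
Local Notation C := R[i].
Local Notation G := (pathgroupoid E).
Local Notation pair := {p : finpath E * finpath E | ptgt p.1 == ptgt p.2}.
Implicit Types (f h : G -> C) (L : seq (C * gis E)) (s t : pair) (B : set G).

Lemma combD L L' g : comb (L ++ L') g = comb L g + comb L' g.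
Proof. by rewrite !combE big_cat. Qed.

Lemma combZ (c : C) L g : comb [seq (c * p.1, p.2) | p <- L] g = c * comb L g.
Proof.
by rewrite !combE big_map mulr_sumr; apply: eq_bigr => p _; rewrite mulrA.
Qed.

Definition is_comb f := exists L, f =1 comb L.

Lemma eq_is_comb f h : f =1 h -> is_comb h -> is_comb f.
Proof. by move=> fh [L hL]; exists L => g; rewrite fh. Qed.

Lemma is_comb0 : is_comb (fun=> 0).
Proof. by exists [::] => g; rewrite combE big_nil. Qed.

Lemma is_combD f h : is_comb f -> is_comb h -> is_comb (fun g => f g + h g).
Proof.
by move=> [L fL] [L' hL']; exists (L ++ L') => g; rewrite combD fL hL'.
Qed.

Lemma is_combZ c f : is_comb f -> is_comb (fun g => c * f g).
Proof. by move=> [L fL]; eexists => g; rewrite fL -combZ. Qed.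

Lemma is_combB f h : is_comb f -> is_comb h -> is_comb (fun g => f g - h g).
Proof.
move=> cf /(is_combZ (-1)) ch; apply: eq_is_comb (is_combD cf ch) => g.
by rewrite mulN1r.
Qed.

Lemma is_comb_chi (s : gis E) : is_comb (chi R s).
Proof. by exists [:: (1, s)] => g; rewrite combE big_seq1 mul1r. Qed.

Definition comb_set B := is_comb (fun g => (g \in B)%:R) /\
  forall f, is_comb f -> is_comb (fun g => (g \in B)%:R * f g).

Lemma comb_set_cyl t : comb_set (pair_cyl t).
Proof.
split; first by apply: eq_is_comb (is_comb_chi (Some t)) => g; rewrite chiE.
move=> f [L fL].
apply: (@eq_is_comb _ (fun g => (g \in pair_cyl t)%:R * comb L g)).
  by move=> g; rewrite fL.
elim: L {fL} => [|[c s] L IH].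
  by apply: eq_is_comb is_comb0 => g; rewrite combE big_nil mulr0.
suff [s' s'E] : exists s' : gis E,
    forall g, chi R s' g = (g \in pair_cyl t)%:R * chi R s g.
  apply: eq_is_comb (is_combD (is_combZ c (is_comb_chi s')) IH) => g.
  by rewrite [X in _ * X]combE big_cons -combE s'E mulrDr mulrCA.
case: s => [s|]; last by exists None => g; exact/esym/mulr0.
have [ts|nts] := pselect (tle t s).
  exists (Some t) => g; rewrite !chiE.
  case: (boolP (g \in pair_cyl t)) => [/set_mem gt|]; last by rewrite mul0r.
  by rewrite mul1r mem_set//; exact: pair_cyl_le gt.
have [st|nst] := pselect (tle s t).
  exists (Some s) => g; rewrite !chiE.
  case: (boolP (g \in pair_cyl s)) => [/set_mem gs|]; last by rewrite mulr0.
  by rewrite mulr1 mem_set//; exact: pair_cyl_le gs.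
exists None => g; rewrite chiE.
case: (boolP (g \in pair_cyl t)) => [/set_mem gt|]; last by rewrite mul0r.
case: (boolP (g \in pair_cyl s)) => [/set_mem gs|]; last by rewrite mulr0.
by have [] := pair_cyl_total gt gs.
Qed.

Lemma comb_setD A B : comb_set A -> comb_set B -> comb_set (A `\` B).
Proof.
move=> [cA mA] [cB mB].
have e g : (g \in A `\` B)%:R = (g \in A)%:R - (g \in B)%:R * (g \in A)%:R :> C.
  rewrite in_setD; case: (g \in A); case: (g \in B);
  by rewrite /= ?mulr1 ?mulr0 ?mul0r ?subrr ?subr0.
split.
  by apply: eq_is_comb e _; apply: is_combB => //; exact: mB.
move=> f cf; apply: (@eq_is_comb _ (fun g => (g \in A)%:R * f g -
    (g \in B)%:R * ((g \in A)%:R * f g))).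
  by move=> g; rewrite e mulrBl mulrA.
by apply: is_combB; [exact: mA | apply: mB; exact: mA].
Qed.

Lemma comb_set_basic B : basics B -> comb_set B.
Proof.
move=> [a [b [ms [ab ams ->]]]].
elim: ms ams => [|m ms IH] ams.
  have -> : basic a b [::] = pair_cyl (mkpair ab).
    rewrite /basic (_ : [set` [::]] = set0) ?bigcup_set0 ?setD0//.
    by apply/seteqP; split.
  exact: comb_set_cyl.
have am : psrc m = ptgt a by apply: ams; rewrite mem_head.
have abm : ptgt (pcat a m) = ptgt (pcat b m) by rewrite !ptgt_cat -?ab.
have -> : basic a b (m :: ms) = basic a b ms `\` pair_cyl (mkpair abm).
  apply/seteqP; split=> [g [gab gm]|g [[gab gms] gm]].
    split; last by move=> h; apply: gm; exists m; rewrite //= mem_head.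
    by split=> // -[k kms gk]; apply: gm; exists k; rewrite //= inE kms orbT.
  split=> // -[k /=]; rewrite inE => /predU1P[->//|kms gk].
  by apply: gms; exists k.
apply: comb_setD (comb_set_cyl _); apply: IH => k kms.
by apply: ams; rewrite inE kms orbT.
Qed.

Lemma step_function (D : seq (set G * C)) :
  (forall d, d \in D -> comb_set d.1) ->
  exists2 f, is_comb f & forall g,
    (exists d, [/\ d \in D, d.1 g & f g = d.2]) \/
    ((forall d, d \in D -> ~ d.1 g) /\ f g = 0).
Proof.
elim: D => [|[B c] D IH] hD.
  by exists (fun=> 0); [exact: is_comb0 | right].
have [|f cf fP] := IH; first by move=> d dD; apply: hD; rewrite inE dD orbT.
have [cB mB] : comb_set B by apply: (hD (B, c)); rewrite mem_head.
exists (fun g => c * (g \in B)%:R + (f g - (g \in B)%:R * f g)).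
  apply: is_combD; first exact: is_combZ.
  by apply: is_combB => //; exact: mB.
move=> g; case: (boolP (g \in B)) => [/set_mem gB|/negP gB].
  left; exists (B, c); rewrite mem_head; split => //.
  by rewrite mulr1 mul1r subrr addr0.
rewrite mulr0 mul0r subr0 add0r.
case: (fP g) => [[d [dD dg fd]]|[nd f0]].
  by left; exists d; rewrite inE dD orbT.
right; split => // d; rewrite inE => /predU1P[->|/nd//] gB'.
by apply: gB; rewrite mem_set.
Qed.

Lemma compact_seq_cover (K : set G) (O : G -> set G) : compact K ->
  (forall g, K g -> open (O g) /\ O g g) ->
  exists2 D : seq G, forall g, g \in D -> K g &
    forall k, K k -> exists2 g, g \in D & O g k.
Proof.
move=> cK hO.
have [[g0 _]|K0] := pselect (exists g, K g); last first.
  by exists [::] => // k Kk; case: K0; exists k.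
(* compact_cover is only available for pointed types. *)
pose pG : ptopologicalType := HB.pack G (isPointed.Build G g0).
have ccK : cover_compact K by move: cK; rewrite (compact_cover pG).
have [|g Kg|D DK KD] := ccK _ K O; first by move=> g /hO[].
  by exists g => //; have [] := hO g Kg.
exists (finmap.enum_fset D); first by move=> g /DK /set_mem.
by move=> k /KD[g gD gk]; exists g.
Qed.

Lemma pair_cyl_cover g : exists t, pair_cyl t g.
Proof.
have /asboolP[a [b [x [ab bx gE]]]] := valP g.
by exists (mkpair ab); exists x.
Qed.

Lemma pair_cyl_open t : open (pair_cyl t).
Proof. exact/cyl_open/pair_tgt. Qed.

Lemma Cc_narrow_cont (f : Cc R E) : continuous (f : G -> C^o) /\
  exists2 K : set G, compact K & forall g, f g != 0 -> K g.
Proof.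
have /asboolP[cf kf] := valP f; split=> //.
by exists (closure [set g | f g != 0]) => // g fg; exact: subset_closure.
Qed.

Lemma Cc_step (f : Cc R E) : exists ts, narrow ts f /\
  forall e : C, 0 < e -> exists2 L,
    forall g, `|f g - comb L g| <= e & narrow ts (f - comb L).
Proof.
have [cf [K cK fK]] := Cc_narrow_cont f.
have /choice[tt ttP] := pair_cyl_cover.
have [|D1 D1K KD1] := @compact_seq_cover K (fun g => pair_cyl (tt g)) cK.
  by move=> g _; split; [exact: pair_cyl_open|exact: ttP].
exists (map tt D1).
have Kts g : K g -> exists2 t, t \in map tt D1 & pair_cyl t g.
  by move=> /KD1[k kD1 kg]; exists (tt k) => //; exact: map_f.
split=> [g /fK/Kts//|e e0].
pose near_f g := [set k | `|f g - f k| < e].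
have hB g : exists B, K g -> [/\ basics B, B g, B `<=` near_f g &
    exists2 t, t \in map tt D1 & B `<=` pair_cyl t].
  have [Kg|nKg] := pselect (K g); last by exists set0.
  have [t tts tg] := Kts g Kg.
  have of_ : nbhs g (near_f g).
    by have /cvgrPdist_lt/(_ e e0) := cf g.
  rewrite nbhsE in of_; case: of_ => U [oU Ug] Uf.
  have [B [bB Bg BU]] := open_basics (openI oU (pair_cyl_open t)) (conj Ug tg).
  exists B => _; split=> //; first by move=> k /BU[/Uf].
  by exists t => // k /BU[].
have /choice[B BP] := hB.
have [|D2 D2K KD2] := @compact_seq_cover K B cK.
  by move=> g Kg; have [b1 b2 _ _] := BP g Kg; split => //; exact: basics_open.
have [|phi [L phiL] phiP] := @step_function [seq (B g, f g) | g <- D2].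
  by move=> d /mapP[g /D2K Kg ->]; apply: comb_set_basic; have [] := BP g Kg.
exists L => [g|g].
  rewrite -phiL; case: (phiP g) => [[d [/mapP[k kD ->] /= kg ->]]|[nD ->]].
    by have [_ _ h _] := BP k (D2K k kD); rewrite distrC; apply/ltW/h.
  have [f0|/fK/KD2[k kD kg]] := eqVneq (f g) 0.
    by rewrite f0 subrr normr0 ltW.
  by case: (nD (B k, f k)) => //; apply/mapP; exists k.
rewrite CcB -phiL; case: (phiP g) => [[d [/mapP[k kD ->] /= kg _ _]]|[nD ->]].
  have [_ _ _ [t tts tB]] := BP k (D2K k kD).
  by exists t => //; exact: tB.
by rewrite subr0 => /fK/Kts.
Qed.

Lemma Cc_dense (f : Cc R E) (e : C) : 0 < e ->
  exists L, I_bounded e (f - comb L : Cc R E).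
Proof.
move=> e0; have [ts [_ h]] := Cc_step f.
have d0 : 0 < e / (size ts).+1%:R by rewrite divr_gt0.
have [L Le Lts] := h _ d0; exists L.
apply: I_bounded_le (I_bounded_narrow (ltW d0) _ Lts); last exact: Le.
by rewrite -[leLHS]mulr_natr -mulrA ger_pMr// mulrC ler_pdivrMr// mul1r ler_nat.
Qed.

End Density.

Section Convolution.
Variables (R : realType) (E : digraph).
Local Notation C := R[i].
Local Notation G := (pathgroupoid E).
Local Notation pair := {p : finpath E * finpath E | ptgt p.1 == ptgt p.2}.
Implicit Types (f h : G -> C) (L : seq (C * gis E)) (s t : pair) (M : C).
Implicit Types (g k l : G).

Lemma gmul_rng k l g : is_gmul k l g -> grng k = grng g.
Proof. by move=> [_ gE]; rewrite /grng gE. Qed.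

Lemma gmul_src k l g : is_gmul k l g -> gsrc l = gsrc g.
Proof. by move=> [_ gE]; rewrite /gsrc gE. Qed.

Lemma gmul_unique k l g g' : is_gmul k l g -> is_gmul k l g' -> g = g'.
Proof. by move=> [_ gE] [_ gE']; apply: val_inj; rewrite gE gE'. Qed.

Lemma gmul_divl k l l' g : is_gmul k l g -> is_gmul k l' g -> l = l'.
Proof.
move=> [kl gE] [kl' gE']; apply: val_inj.
move: gE'; rewrite gE => -[/addrI dl sl].
have val3 (m : G) : val m = (grng m, gdeg m, gsrc m).
  by rewrite [LHS]surjective_pairing [(val m).1]surjective_pairing.
by rewrite [LHS]val3 [RHS]val3 -kl -kl' dl sl.
Qed.

Local Notation factors g := [set kl : G * G | is_gmul kl.1 kl.2 g].

Lemma convol_seq (ts : seq pair) g : exists P : seq (G * G),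
  (forall kl, kl \in P -> is_gmul kl.1 kl.2 g) /\
  forall f h, narrow ts f -> convol f h g = \sum_(kl <- P) f kl.1 * h kl.2.
Proof.
pose A := [set kl : G * G | is_gmul kl.1 kl.2 g /\
  exists2 t, t \in ts & pair_cyl t kl.1].
have fA : finite_set A.
  pose B t := [set kl : G * G | is_gmul kl.1 kl.2 g /\ pair_cyl t kl.1].
  apply: (@sub_finite_set _ _ (\bigcup_(t in [set` ts]) B t)).
    by move=> kl [gkl [t tts tk]]; exists t.
  apply: bigcup_finite; first exact: finite_seq.
  move=> t _; have [[kl Bkl]|nB] := pselect (exists kl, B t kl); last first.
    rewrite (_ : B t = set0); first exact: finite_set0.
    by apply/seteqP; split=> // kl Bkl; case: nB; exists kl.
  apply: (@sub_finite_set _ _ [set kl]); last exact: finite_set1.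
  case: kl Bkl => k l [/= gkl tk] [k' l'] [/= gkl' tk'].
  have kk : k' = k.
    apply: (pair_cyl_inj (r := true) tk' tk).
    by rewrite /= (gmul_rng gkl) (gmul_rng gkl').
  by rewrite kk in gkl' *; rewrite (gmul_divl gkl gkl').
exists (finmap.enum_fset (fset_set A)); split.
  by move=> kl; rewrite in_fset_set// => /set_mem[].
move=> f h nf; rewrite /convol -(fsbig_widen A).
- by rewrite fsbig_finite.
- by move=> kl [].
- move=> kl [/= gkl nA] /=; have [->|f0] := eqVneq (f kl.1) 0.
    by rewrite mul0r.
  by case: nA; split => //; exact: nf.
Qed.

Lemma pairs_bound (P : seq (G * G)) (f h : G -> C) (M M' : C) : uniq P ->
  (forall g, 0 <= f g) -> (forall g, 0 <= h g) -> 0 <= M' ->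
  (forall D, uniq D -> (forall k, k \in D -> exists l, (k, l) \in P) ->
     \sum_(k <- D) f k <= M) ->
  (forall D k, uniq D -> (forall l, l \in D -> (k, l) \in P) ->
     \sum_(l <- D) h l <= M') ->
  \sum_(kl <- P) f kl.1 * h kl.2 <= M * M'.
Proof.
move=> uP f0 h0 M'0 fM hM.
pose D := undup (map fst P).
have -> : \sum_(kl <- P) f kl.1 * h kl.2 =
    \sum_(k <- D) f k * \sum_(l <- [seq kl.2 | kl <- P & kl.1 == k]) h l.
  under [RHS]eq_bigr do rewrite big_map big_filter mulr_sumr big_mkcond.
  rewrite exchange_big /= big_seq [RHS]big_seq; apply: eq_bigr => kl klP.
  have kD : kl.1 \in D by rewrite mem_undup map_f.
  rewrite (bigD1_seq kl.1)//= ?undup_uniq// eqxx big1 ?addr0// => k.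
  by rewrite eq_sym => /negPf ->.
apply: (@le_trans _ _ (\sum_(k <- D) f k * M')).
  apply: ler_sum => k _; apply: ler_wpM2l => //; apply: (hM _ k).
    rewrite map_inj_in_uniq ?filter_uniq// => -[a b] [c d].
    by rewrite !mem_filter /= => /andP[/eqP -> _] /andP[/eqP -> _] ->.
  move=> l /mapP[[a b]]; rewrite mem_filter /= => /andP[/eqP <- ?] ->.
  by [].
rewrite -mulr_suml; apply: ler_wpM2r => //; apply: fM; first exact: undup_uniq.
by move=> k; rewrite mem_undup => /mapP[[a b] abP ->]; exists b.
Qed.

(* When infinitely many factorizations contribute, the sum defining convol has
   the junk value 0 and finite_support is empty, so the bound holds as well. *)
Lemma I_bounded_convol M M' f h : I_bounded M f -> I_bounded M' h ->
  I_bounded (M * M') (convol f h).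
Proof.
move=> bf bh r u D uD Du.
have M0 := I_bounded_ge0 bf u; have M'0 := I_bounded_ge0 bh u.
pose Q g := finite_support 0 (factors g) (fun kl => f kl.1 * h kl.2).
have QP g kl : kl \in Q g -> is_gmul kl.1 kl.2 g.
  rewrite /Q; have [fin|inf] := pselect (finite_set (factors g `&`
      (fun kl => f kl.1 * h kl.2) @^-1` [set~ 0])).
    by rewrite in_finite_support// => /set_mem[].
  by rewrite no_finite_support.
pose P := flatten [seq Q g | g <- D].
have PD k l : (k, l) \in P -> exists2 g, g \in D & is_gmul k l g.
  by move=> /flattenP[_ /mapP[g gD ->] /QP kl]; exists g.
have uP : uniq P.
  rewrite /P; elim: D uD {Du P PD} => [//|g D IH] /= /andP[gD uD].
  rewrite cat_uniq IH// finite_support_uniq andbT /=; apply/hasPn => kl.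
  move=> /flattenP[_ /mapP[k kD ->] /QP klk]; apply/negP => /QP klg.
  by move/negP: gD; apply; rewrite (gmul_unique klg klk).
apply: (@le_trans _ _ (\sum_(kl <- P) `|f kl.1| * `|h kl.2|)).
  rewrite big_flatten big_map; apply: ler_sum => g _.
  apply: le_trans (ler_norm_sum _ _ _) _; apply: ler_sum => kl _.
  by rewrite normrM.
case: r Du => Du.
  apply: (@pairs_bound P (fun g => `|f g|) (fun g => `|h g|)) => //.
  - move=> D' uD' D'P; apply: (bf true u) => // k /D'P[l /PD[g gD gkl]].
    by rewrite /= (gmul_rng gkl); exact: Du.
  - move=> D' k uD' D'P; apply: (bh true (gsrc k)) => // l /D'P/PD[g _ [+ _]].
    by move=> ->.
rewrite mulrC.
have -> : \sum_(kl <- P) `|f kl.1| * `|h kl.2| =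
    \sum_(lk <- [seq (kl.2, kl.1) | kl <- P]) `|h lk.1| * `|f lk.2|.
  by rewrite big_map; apply: eq_bigr => kl _; rewrite mulrC.
have sP k l : (l, k) \in [seq (kl.2, kl.1) | kl <- P] -> (k, l) \in P.
  by move=> /mapP[[a b] abP [-> ->]].
apply: (@pairs_bound _ (fun g => `|h g|) (fun g => `|f g|)) => //.
- by rewrite map_inj_uniq// => -[a b] [c d] [-> ->].
- move=> D' uD' D'P; apply: (bh false u) => // l /D'P[k /sP/PD[g gD gkl]].
  by rewrite /= (gmul_src gkl); exact: Du.
- move=> D' l uD' D'P; apply: (bf false (grng l)) => // k /D'P/sP/PD[g _ []].
  by [].
Qed.

Lemma convol_chi (s t : gis E) g :
  convol (chi R s) (chi R t) g = chi R (smul s t) g.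
Proof.
have zero_l f : convol (fun=> 0) f g = 0.
  by apply: fsbig1 => kl _; rewrite mul0r.
have zero_r f : convol f (fun=> 0) g = 0.
  by apply: fsbig1 => kl _; rewrite mulr0.
case: s => [s|]; last exact: zero_l.
case: t => [t|]; last by rewrite [RHS](_ : _ = 0) //; exact: zero_r.
have out : (forall k l, pair_cyl s k -> pair_cyl t l -> ~ is_gmul k l g) ->
    convol (chi R (Some s)) (chi R (Some t)) g = 0.
  move=> nkl; apply: fsbig1 => -[k l] /= gkl; rewrite !indicE.
  case: (boolP (k \in _)) => [/set_mem sk|]; last by rewrite mul0r.
  case: (boolP (l \in _)) => [/set_mem tl|]; last by rewrite mulr0.
  by case: (nkl k l).
have inn k l : pair_cyl s k -> pair_cyl t l -> is_gmul k l g ->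
    convol (chi R (Some s)) (chi R (Some t)) g = 1.
  move=> sk tl gkl; rewrite /convol -(fsbig_widen [set (k, l)]).
  - by rewrite fsbig_set1 !chiE !mem_set ?mulr1.
  - by move=> _ ->.
  - move=> [k' l'] [/= gkl' ne] /=; rewrite !indicE.
    case: (boolP (k' \in _)) => [/set_mem sk'|]; last by rewrite mul0r.
    case: (boolP (l' \in _)) => [/set_mem tl'|]; last by rewrite mulr0.
    case: ne; congr (_, _).
      apply: (pair_cyl_inj (r := true) sk' sk).
      by rewrite /= (gmul_rng gkl) (gmul_rng gkl').
    apply: (pair_cyl_inj (r := false) tl' tl).
    by rewrite /= (gmul_src gkl) (gmul_src gkl').
have := smulP (pair_tgt s) (pair_tgt t); rewrite !spp_val.
have sst := pair_tgt s; have tst := pair_tgt t.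
case=> [m cm bE|m bm cE|cb bc].
- have dm : ptgt (val t).2 = psrc m by rewrite -tst.
  have am : ptgt (val s).1 = ptgt (pcat (val t).2 m).
    by rewrite sst bE !ptgt_cat.
  have -> : spp (val s).1 (pcat (val t).2 m) = Some (mkpair am).
    by rewrite -spp_val.
  rewrite chiE; case: (boolP (g \in _)) => [/set_mem|/negP ng].
    move=> [x /=]; rewrite ptgt_cat// => mx gE0.
    have {gE0}gE : val g = _ := gE0.
    have bx : ptgt (val s).2 = xsrc x by rewrite bE ptgt_cat.
    have tx : ptgt (val t).2 = xsrc (xcat m x) by rewrite xsrc_cat.
    have [k kE] := pair_cyl_elt bx; have [l lE] := pair_cyl_elt tx.
    apply: (inn k l); [by exists x|by exists (xcat m x)|split].
      by rewrite /gsrc /grng kE lE /= bE xcatA.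
    rewrite gE /gsrc /grng /gdeg kE lE /= bE !plen_cat// xcatA//.
    by congr (_, _, _) => /=; lia.
  apply: out => k l [x bx kE] [y dy lE] [kl gE]; apply: ng; apply/mem_set.
  have mx : ptgt m = xsrc x by rewrite -bx bE ptgt_cat.
  have yE : y = xcat m x.
    move: kl; rewrite /gsrc /grng kE lE /= bE xcatA// => /xcat_injl -> //.
      by rewrite xsrc_cat.
    by rewrite tst.
  exists x; rewrite /= ?ptgt_cat// gE /gsrc /grng /gdeg kE lE /= bE !plen_cat//.
  by rewrite yE xcatA//; congr (_, _, _) => /=; lia.
- have am : ptgt (val s).1 = psrc m by rewrite sst.
  have amd : ptgt (pcat (val s).1 m) = ptgt (val t).2.
    by rewrite -tst cE !ptgt_cat.
  have -> : spp (pcat (val s).1 m) (val t).2 = Some (mkpair amd).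
    by rewrite -spp_val.
  rewrite chiE; case: (boolP (g \in _)) => [/set_mem|/negP ng].
    move=> [y /= dy gE0]; have {gE0}gE : val g = _ := gE0.
    have my : ptgt m = xsrc y by rewrite -dy -tst cE ptgt_cat.
    have bx : ptgt (val s).2 = xsrc (xcat m y) by rewrite xsrc_cat.
    have [k kE] := pair_cyl_elt bx; have [l lE] := pair_cyl_elt dy.
    apply: (inn k l); [by exists (xcat m y)|by exists y|split].
      by rewrite /gsrc /grng kE lE /= cE xcatA.
    rewrite gE /gsrc /grng /gdeg kE lE /= cE !plen_cat// xcatA//.
    by congr (_, _, _) => /=; lia.
  apply: out => k l [x bx kE] [y dy lE] [kl gE]; apply: ng; apply/mem_set.
  have my : ptgt m = xsrc y by rewrite -dy -tst cE ptgt_cat.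
  have xE : x = xcat m y.
    move: kl; rewrite /gsrc /grng kE lE /= cE xcatA// => /xcat_injl -> //.
    by rewrite xsrc_cat.
  exists y => //=; rewrite gE /gsrc /grng /gdeg kE lE /= cE !plen_cat//.
  by rewrite xE xcatA//; congr (_, _, _) => /=; lia.
apply: out => k l [x bx kE] [y dy lE] [kl gE].
have kb : unit_cyl (val s).2 (gsrc k) by exists x; rewrite // /gsrc kE.
have kc : unit_cyl (val t).1 (gsrc k) by exists y; rewrite ?tst// kl /grng lE.
have [bc_|/ltnW cb_] := leqP (plen (val s).2) (plen (val t).1).
  by move: bc; rewrite (unit_cyl_cmp kb kc bc_).
by move: cb; rewrite (unit_cyl_cmp kc kb cb_).
Qed.

Definition cmul L L' : seq (C * gis E) :=
  [seq (p.1 * q.1, smul p.2 q.2) | p <- L, q <- L'].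

Lemma comb_narrow L : exists ts, narrow ts (comb L).
Proof.
exists (pmap id [seq p.2 | p <- L]) => g; rewrite combE => g0.
apply: contrapT => nt; move/eqP: g0; apply.
rewrite big_seq big1// => -[c [s|]] pL; last exact: mulr0.
rewrite chiE memNset ?mulr0// => sg; apply: nt; exists s => //.
by rewrite mem_pmap map_id; apply/mapP; exists (c, Some s).
Qed.

Lemma narrow_cat ts ts' f : narrow ts f -> narrow (ts ++ ts') f.
Proof. by move=> nf g /nf[t tts tg]; exists t; rewrite ?mem_cat ?tts. Qed.

Lemma narrow_catr ts ts' f : narrow ts' f -> narrow (ts ++ ts') f.
Proof. by move=> nf g /nf[t tts tg]; exists t; rewrite ?mem_cat ?tts ?orbT. Qed.

Lemma convol_comb L L' g : convol (comb L) (comb L') g = comb (cmul L L') g.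
Proof.
have [ts nts] := comb_narrow L.
pose us := pmap id [seq p.2 | p <- L].
have [P [_ PE]] := convol_seq (ts ++ us) g.
have chi_us p : p \in L -> narrow (ts ++ us) (chi R p.2).
  case: p => c [s|] pL; last by move=> k; rewrite eqxx.
  move=> k kN; have [s' + sk] := narrow_chi kN; rewrite inE => /eqP e.
  exists s; last by rewrite -e.
  rewrite mem_cat mem_pmap map_id; apply/orP; right; apply/mapP.
  by exists (c, Some s).
rewrite PE; last exact: narrow_cat.
rewrite combE big_allpairs_dep /=.
under eq_bigr do rewrite !combE mulr_suml.
rewrite exchange_big /= big_seq [RHS]big_seq; apply: eq_bigr => p pL.
under eq_bigr do rewrite mulr_sumr.
rewrite exchange_big /=; apply: eq_bigr => q _.
rewrite -convol_chi PE; last exact: chi_us.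
by rewrite mulr_sumr; apply: eq_bigr => kl _; rewrite mulrACA.
Qed.

Lemma I_bounded_convolB (f f' h h' : G -> C) (M M' e e' : C) ts ts' :
  narrow ts f -> narrow ts' f' ->
  I_bounded M' h -> I_bounded M f' ->
  I_bounded e (fun g => f g - f' g) -> I_bounded e' (fun g => h g - h' g) ->
  I_bounded (e * M' + M * e') (fun g => convol f h g - convol f' h' g).
Proof.
move=> nf nf' bh bf' be be'.
have b1 := I_bounded_convol be bh; have b2 := I_bounded_convol bf' be'.
apply: eq_I_bounded (I_boundedD b1 b2) => g.
have [P [_ PE]] := convol_seq (ts ++ ts') g.
have nff : narrow (ts ++ ts') (fun g => f g - f' g).
  move=> k; have [f0|/nf[t tts tk] _] := eqVneq (f k) 0; last first.
    by exists t; rewrite ?mem_cat ?tts.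
  rewrite f0 sub0r oppr_eq0 => /nf'[t tts tk].
  by exists t; rewrite ?mem_cat ?tts ?orbT.
rewrite !PE//; [|exact: narrow_catr|exact: narrow_cat|exact: narrow_catr].
rewrite -big_split -sumrB; apply: eq_bigr => kl _ /=.
by rewrite mulrBl mulrBr addrA subrK.
Qed.

Definition cstar L : seq (C * gis E) := [seq (p.1^*, sstar p.2) | p <- L].

Lemma chi_star (s : gis E) g : chi R (sstar s) g = (chi R s (ginv g))^*.
Proof.
case: s => [s|]; last exact/esym/conjC0.
rewrite -(spp_val s) sstar_spp ?pair_tgt//.
have ts := esym (pair_tgt s).
have -> : spp (val s).2 (val s).1 = Some (mkpair ts) by rewrite -spp_val.
rewrite spp_val !chiE /pair_cyl /= -(ginv_cyl (pair_tgt s)).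
rewrite (_ : (g \in _) = (ginv g \in cyl (val s).1 (val s).2)).
  by rewrite conjC_nat.
by apply/idP/idP => /set_mem h; apply/mem_set.
Qed.

Lemma comb_star L g : comb (cstar L) g = (comb L (ginv g))^*.
Proof.
rewrite !combE big_map rmorph_sum; apply: eq_bigr => p _.
by rewrite chi_star rmorphM.
Qed.

Lemma Cc_sumE (I : Type) (r : seq I) (F : I -> Cc R E) g :
  (\sum_(i <- r) F i) g = \sum_(i <- r) F i g.
Proof.
elim: r => [|i r IH]; first by rewrite !big_nil.
by rewrite !big_cons CcD IH.
Qed.

Definition diag (a : finpath E) : pair := mkpair (erefl (ptgt a)).

Lemma chi_vert (v : vertex E) : Vfin v ->
  chi R (spp (vpath v) (vpath v)) =
  \sum_(e <- finmap.enum_fset (fset_set (out v)))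
    chi R (spp (epath e) (epath e)).
Proof.
move=> fv; apply: Cc_ext => g; rewrite Cc_sumE.
have sppd (a : finpath E) : spp a a = Some (diag a) by rewrite -spp_val.
rewrite sppd chiE; under eq_bigr do rewrite sppd chiE.
have nin e : out v e -> ~ pair_cyl (diag (vpath v)) g ->
    ~ pair_cyl (diag (epath e)) g.
  move=> ev gv ge; apply: gv; apply: pair_cyl_le ge.
  exists (epath e); split=> //=; rewrite -ev.
    exact/esym/(vpath_cat (epath e)).
  exact/esym/(vpath_cat (epath e)).
have outP e : e \in finmap.enum_fset (fset_set (out v)) = (e \in out v).
  exact: in_fset_set.
have [gv|gv] := pselect (pair_cyl (diag (vpath v)) g); last first.
  rewrite memNset// big_seq big1// => e; rewrite outP => /set_mem ev.
  by rewrite memNset//; exact: nin.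
have [x vx gE] := gv.
have [[y xE yE]|[e [x' [ex ex' xE]]]] := xcase x.
  by have /asboolP := valP y; rewrite yE -vx; case.
have ev : esrc e = v by rewrite ex -vx.
have ge : pair_cyl (diag (epath e)) g.
  exists x' => //; rewrite gE xE /= !subrr -!xcatA//.
  by rewrite -ev (vpath_cat (epath e)).
have eD : e \in finmap.enum_fset (fset_set (out v)).
  by rewrite outP; exact/mem_set.
rewrite (bigD1_seq e)//= ?finmap.fset_uniq// !mem_set// big1 ?addr0// => f fe.
rewrite memNset// => gf.
have := unit_cyl_cmp (unit_cyl_gend true ge) (unit_cyl_gend true gf) (leqnn _).
by rewrite /= epath_prefix eq_sym (negPf fe).
Qed.

End Convolution.

(** * Representations of the groupoid *)

Section Integration.
Variables (R : realType) (H : hilbertType R) (E : digraph).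
Local Notation C := R[i].
Local Notation G := (pathgroupoid E).
Local Notation "''[' x , y ]" := (hdot H x y).
Implicit Types (f h k : Cc R E) (L : seq (C * gis E)) (M e : C).
Implicit Types (x y z : H).

Lemma le_small (a b K : C) : 0 <= K -> (forall e, 0 < e -> a <= b + e * K) ->
  a <= b.
Proof.
move=> K0 h; apply/ler_addgt0Pr => e e0.
have K1 : 0 < 1 + K by rewrite ltr_wpDr.
apply: (le_trans (h (e / (1 + K)) (divr_gt0 e0 K1))).
by rewrite lerD2l -mulrA ger_pMr// mulrC ler_pdivrMr// mul1r lerDr.
Qed.

Lemma eq_small (x y : H) (K : C) : 0 <= K ->
  (forall e, 0 < e -> `|x - y| <= e * K) -> x = y.
Proof.
move=> K0 h; apply/eqP; rewrite -subr_eq0 -normr_le0.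
by apply: (le_small K0) => e e0; rewrite add0r; exact: h.
Qed.

Lemma real_part_pos (e : C) : 0 < e -> exists2 r : R, 0 < r & e = r%:C%C.
Proof.
move=> e0; exists (complex.Re e); last by rewrite RRe_real// gtr0_real.
by rewrite -ltcR RRe_real// gtr0_real.
Qed.

Section GroupoidToGis.
Variables (pi : Cc R E -> bop H) (rpi : is_groupoid_rep pi).

Lemma groupoid_rep0 x : pi 0 x = 0.
Proof.
have := pr_linear rpi (-1) 0 0 x.
by rewrite scaler0 addr0 scaleN1r addNr.
Qed.

Lemma groupoid_repD f h x : pi (f + h) x = pi f x + pi h x.
Proof. by rewrite -{1}[f]scale1r (pr_linear rpi) scale1r. Qed.

Lemma groupoid_repZ (c : C) f x : pi (c *: f) x = c *: pi f x.
Proof. by rewrite -[c *: f]addr0 (pr_linear rpi) groupoid_rep0 addr0. Qed.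

Lemma groupoid_rep_sum (I : Type) (s : seq I) (F : I -> Cc R E) x :
  pi (\sum_(i <- s) F i) x = \sum_(i <- s) pi (F i) x.
Proof.
elim: s => [|i s IH]; first by rewrite !big_nil groupoid_rep0.
by rewrite !big_cons groupoid_repD IH.
Qed.

Lemma groupoid_rep_comb L x :
  pi (comb L) x = lincomb (fun s => pi (chi R s)) L x.
Proof.
rewrite groupoid_rep_sum; apply: eq_bigr => p _; exact: groupoid_repZ.
Qed.

Lemma groupoid_rep_approx f x e : 0 < e -> exists2 d : R, 0 < d &
  forall L, I_bounded d%:C%C (f - comb L : Cc R E) ->
    `|pi f x - lincomb (fun s => pi (chi R s)) L x| <= e.
Proof.
move=> e0; have K1 : 0 < 1 + `|x| by rewrite ltr_wpDr.
have [r r0 rE] := real_part_pos (divr_gt0 e0 K1).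
have [d d0 dP] := pr_cont rpi f r0; exists (d / 2); first by rewrite divr_gt0.
move=> L bL; rewrite -groupoid_rep_comb distrC; apply: le_trans (dP _ _ x) _.
  apply: (@le_lt_trans _ _ (d / 2)%:E%E).
    apply/I_normP; first by rewrite divr_ge0// ltW.
    by apply: I_bounded_norm bL => g; rewrite !CcB distrC lexx.
  by rewrite lte_fin ltr_pdivrMr// ltr_pMr// ltr1n.
rewrite -rE -mulrA ger_pMr// mulrC ler_pdivrMr// mul1r.
by rewrite lerDr.
Qed.

Lemma groupoid_gis_rep : is_gis_rep (fun s => pi (chi R s)).
Proof.
split.
- move=> s t x; rewrite (pr_mul rpi (f := chi R s) (h := chi R t))//.
  by apply/funext => g; rewrite convol_chi.
- move=> s; have -> : chi R (sstar s) = Cc_star (chi R s).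
    by apply: Cc_ext => g; rewrite chi_star.
  exact: pr_star.
- by move=> x; exact: groupoid_rep0.
- move=> v fv x; rewrite chi_vert// groupoid_rep_sum.
  by rewrite [X in _ - X]fsbig_finite ?subrr.
- have appr (s : seq (Cc R E * H)) e : 0 < e -> exists s' : seq (gis E * H),
      `|\sum_(p <- s) pi p.1 p.2 - \sum_(p <- s') pi (chi R p.1) p.2| <= e.
    elim: s e => [|[f y] s IH] e e0.
      by exists [::]; rewrite !big_nil subrr normr0 ltW.
    have e2 : 0 < e / 2 by rewrite divr_gt0.
    have [s' s'E] := IH _ e2; have [d d0 dP] := groupoid_rep_approx f y e2.
    have [|L /dP LE] := @Cc_dense _ _ f d%:C%C; first by rewrite ltcR.
    exists ([seq (p.2, p.1 *: y) | p <- L] ++ s').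
    rewrite big_cons big_cat big_map /= opprD addrACA [e]splitr.
    apply: le_trans (ler_normD _ _) (lerD _ s'E).
    rewrite (eq_bigr (fun p => p.1 *: pi (chi R p.2) y)); first exact: LE.
    by move=> p _; exact: linearZ.
  move=> A A0 oA; have [x [Ax [s xE]]] := pr_nondeg rpi A0 oA.
  have /nbhs_ballP[e /= e0 eA] : nbhs x A by exact: open_nbhs_nbhs.
  have e2 : 0 < e / 2 by rewrite divr_gt0.
  have [s' s'E] := appr s _ e2.
  exists (\sum_(p <- s') pi (chi R p.1) p.2); split; last by exists s'.
  apply: eA; rewrite -ball_normE /= xE; apply: le_lt_trans s'E _.
  by rewrite ltr_pdivrMr// ltr_pMr// ltr1n.
Qed.

End GroupoidToGis.

Lemma groupoid_rep_eq (pi pi' : Cc R E -> bop H) :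
  is_groupoid_rep pi -> is_groupoid_rep pi' ->
  (forall s, pi (chi R s) = pi' (chi R s)) -> pi = pi'.
Proof.
move=> r r' chiE; apply/funext => f; apply: bop_ext => x.
apply: (@eq_small _ _ 2%:R) => // e e0.
have [d d0 dP] := groupoid_rep_approx r f x e0.
have [d' d'0 dP'] := groupoid_rep_approx r' f x e0.
have m0 : 0 < Num.min d d' by rewrite lt_min d0.
have [|L bL] := @Cc_dense _ _ f (Num.min d d')%:C%C; first by rewrite ltcR.
have {}dP : `|pi f x - lincomb (fun s => pi (chi R s)) L x| <= e.
  by apply: dP; apply: I_bounded_le bL; rewrite lecR ge_min lexx.
have {}dP' : `|pi' f x - lincomb (fun s => pi (chi R s)) L x| <= e.
  rewrite (_ : lincomb _ _ _ = lincomb (fun s => pi' (chi R s)) L x).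
    by apply: dP'; apply: I_bounded_le bL; rewrite lecR ge_min lexx orbT.
  by apply: eq_bigr => p _; rewrite chiE.
rewrite mulr_natr mulr2n; rewrite distrC in dP'.
apply: le_trans (lerD dP dP'); exact: ler_distD.
Qed.

Section GisToGroupoid.
Variables (Pi : gis E -> bop H).
Hypotheses (rPi : is_gis_rep Pi) (hE : no_sinks E).

Lemma lincomb_cat L L' x :
  lincomb Pi (L ++ L') x = lincomb Pi L x + lincomb Pi L' x.
Proof. by rewrite /lincomb big_cat. Qed.

Lemma lincomb_scale (c : C) L x :
  lincomb Pi [seq (c * p.1, p.2) | p <- L] x = c *: lincomb Pi L x.
Proof.
by rewrite /lincomb big_map scaler_sumr; apply: eq_bigr => p _; rewrite scalerA.
Qed.

Lemma lincomb_linear L (c : C) x y :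
  lincomb Pi L (c *: x + y) = c *: lincomb Pi L x + lincomb Pi L y.
Proof.
rewrite /lincomb scaler_sumr -big_split; apply: eq_bigr => p _ /=.
by rewrite linearP scalerDr !scalerA mulrC.
Qed.

Lemma lincomb_dist L L' f e e' x : 0 < e -> 0 < e' ->
  I_bounded e (f - comb L : Cc R E) -> I_bounded e' (f - comb L' : Cc R E) ->
  `|lincomb Pi L x - lincomb Pi L' x| <= (e + e') * `|x|.
Proof.
move=> e0 e'0 bL bL'.
have -> : lincomb Pi L x - lincomb Pi L' x =
    lincomb Pi (L ++ [seq (-1 * p.1, p.2) | p <- L']) x.
  by rewrite lincomb_cat lincomb_scale scaleN1r.
apply: lincomb_bound => //; first by rewrite addr_ge0 ?ltW.
apply: eq_I_bounded (I_boundedD (I_boundedN bL) bL') => g.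
by rewrite combD combZ mulN1r !CcB opprB addrA subrK.
Qed.

Lemma integral_exists (f : Cc R E) x : exists y : H, forall e L, 0 < e ->
  I_bounded e (f - comb L : Cc R E) -> `|y - lincomb Pi L x| <= e * `|x|.
Proof.
pose F : set_system (seq (C * gis E)) := filter_from [set e : C | 0 < e]
  (fun e => [set L | I_bounded e (f - comb L : Cc R E)]).
have FF : ProperFilter F.
  apply: filter_from_proper; last by move=> e /= e0; exact: Cc_dense.
  apply: filter_from_filter; first by exists 1 => /=.
  move=> e e' /= e0 e'0.
  have [ee|ee] := real_leP (gtr0_real e0) (gtr0_real e'0).
    by exists e => // L /= bL; split=> //; exact: I_bounded_le bL.
  by exists e' => // L /= bL; split=> //; apply: I_bounded_le bL; exact: ltW.
have cauchyF : cauchy (fmap (fun L => lincomb Pi L x) F).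
  apply: cauchy_exP => e e0.
  have K0 : 0 < 1 + `|x| by rewrite ltr_wpDr.
  have d0 : 0 < e / 2 / (1 + `|x|) by rewrite !divr_gt0.
  have [L bL] := Cc_dense f d0.
  exists (lincomb Pi L x), (e / 2 / (1 + `|x|)) => //.
  move=> L' /= bL'; rewrite -ball_normE /=.
  apply: le_lt_trans (lincomb_dist x d0 d0 bL bL') _.
  rewrite -mulrDl -splitr -mulrA gtr_pMr// mulrC ltr_pdivrMr// mul1r.
  by rewrite ltrDr.
have Fy := cauchy_cvg _ cauchyF; move: Fy; set y := lim _.
move=> /(_ (fmap_proper_filter _ FF)) Fy.
exists y => e L e0 bL.
have K0 : 0 <= 1 + `|x| by rewrite addr_ge0.
apply: (le_small K0) => d d0.
have /cvgrPdist_lt/(_ d d0)[d' d'0 h] : lincomb Pi L x @[L --> F] --> y := Fy.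
have [m m0 [md md']] : exists2 m : C, 0 < m & m <= d /\ m <= d'.
  have [dd|dd] := real_leP (gtr0_real d0) (gtr0_real d'0).
    by exists d.
  by exists d' => //; split=> //; exact: ltW.
have [L' bL'] := Cc_dense f m0.
have /ltW h' := h L' (I_bounded_le md' bL').
apply: le_trans (ler_distD (lincomb Pi L' x) _ _) _.
apply: le_trans (lerD h' (lincomb_dist x m0 e0 bL' bL)) _.
rewrite mulrDl mulrDr mulr1 [leRHS]addrC -[leRHS]addrA lerD2l lerD2r.
exact: ler_wpM2r.
Qed.

End GisToGroupoid.

End Integration.

Lemma bop_exists (R : realType) (H : hilbertType R) (T : H -> H) (M : R[i]) :
  linear T -> 0 <= M -> (forall x, `|T x| <= M * `|x|) ->
  exists S : bop H, forall x, S x = T x.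
Proof.
move=> lT M0 bT.
pose T' : {linear H -> H} := HB.pack T (GRing.isLinear.Build _ _ _ _ T lT).
by exists (Bop (bop_bound_cont (T := T') M0 bT)).
Qed.

Lemma hdot_le_norm (R : realType) (H : hilbertType R) (x y : H) :
  `|hdot H x y| <= `|x| * `|y|.
Proof.
have [->|x0] := eqVneq x 0; first by rewrite linear0l !normr0 mul0r.
have [->|y0] := eqVneq y 0; first by rewrite linear0r !normr0 mulr0.
have nx : 0 < `|x| by rewrite normr_gt0.
have ny : 0 < `|y| by rewrite normr_gt0.
have := hdot_le_normD (`|x|^-1 *: x) (`|y|^-1 *: y).
rewrite linearZl_LR linearZr_LR /= !normrM norm_conjC !normrZ !normfV !normr_id.
rewrite !mulVf ?gt_eqF// expr1n -[1 + 1]/(1 *+ 2) lerMn2r /=.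
by rewrite mulrA -invfM mulrC ler_pdivrMr ?mulr_gt0// mul1r.
Qed.

Lemma subr_pairwise (V : zmodType) (a b c m n : V) :
  a - (b + c) = (a - (m + n)) - ((b - m) + (c - n)).
Proof. by rewrite [b - m + _]addrACA -opprD opprB addrA subrK. Qed.

Section Integral.
Variables (R : realType) (H : hilbertType R) (E : digraph).
Local Notation C := R[i].
Local Notation "''[' x , y ]" := (hdot H x y).
Implicit Types (f h k : Cc R E) (L : seq (C * gis E)) (M e : C).
Implicit Types (x y z : H).
Variables (Pi : gis E -> bop H).
Hypotheses (rPi : is_gis_rep Pi) (hE : no_sinks E).

Lemma Cc_I_bounded f : exists2 M, 0 <= M & I_bounded M f.
Proof.
have [L bL] := Cc_dense f (ltr01 : 0 < 1 :> C).
have [M M0 bM] := I_bounded_comb L.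
exists (1 + M); first by rewrite addr_ge0.
by apply: eq_I_bounded (I_boundedD bL bM) => g; rewrite CcB subrK.
Qed.

Lemma I_bounded_approx f L M e : I_bounded M f ->
  I_bounded e (f - comb L : Cc R E) -> I_bounded (M + e) (comb L).
Proof.
move=> bf bL; apply: eq_I_bounded (I_boundedD bf (I_boundedN bL)) => g.
by rewrite CcB opprB addrC subrK.
Qed.

Definition integrates (T : Cc R E -> H -> H) := forall f x e L, 0 < e ->
  I_bounded e (f - comb L : Cc R E) -> `|T f x - lincomb Pi L x| <= e * `|x|.

Lemma integral_bound (T : Cc R E -> H -> H) f x M : integrates T -> 0 <= M ->
  I_bounded M f -> `|T f x| <= M * `|x|.
Proof.
move=> hT M0 bf; apply: (@le_small _ _ _ (`|x| * 2%:R)) => [|e e0].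
  by rewrite mulr_ge0.
have [L bL] := Cc_dense f e0.
rewrite -[T f x](subrK (lincomb Pi L x)).
apply: le_trans (ler_normD _ _) _.
have Me0 : 0 <= M + e by rewrite addr_ge0// ltW.
have bL' := lincomb_bound rPi hE x Me0 (I_bounded_approx bf bL).
apply: le_trans (lerD (hT f x e L e0 bL) bL') _.
by rewrite mulrDl addrCA mulr_natr mulr2n mulrDr.
Qed.

Lemma integral_linear (T : Cc R E -> H -> H) f : integrates T -> linear (T f).
Proof.
move=> hT c x y; pose K := `|c *: x + y| + (`|c| * `|x| + `|y|).
apply: (@eq_small _ _ _ _ K); first by rewrite !addr_ge0// mulr_ge0.
move=> e e0; have [L bL] := Cc_dense f e0.
rewrite (subr_pairwise _ _ _ (c *: lincomb Pi L x) (lincomb Pi L y)).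
rewrite -lincomb_linear -scalerBr.
apply: le_trans (ler_normB _ _) _; rewrite /K mulrDr.
apply: lerD; first exact: hT.
apply: le_trans (ler_normD _ _) _; rewrite mulrDr; apply: lerD; last exact: hT.
by rewrite normrZ mulrCA; apply: ler_wpM2l => //; exact: hT.
Qed.

Lemma integral_op : exists pi : Cc R E -> bop H, integrates pi.
Proof.
pose T f x := projT1 (cid (integral_exists rPi hE f x)).
have hT : integrates T.
  by move=> f x e L e0 bL; rewrite /T; case: cid => /= y; apply.
suff /choice[pi piT] : forall f, exists S : bop H, forall x, S x = T f x.
  by exists pi => f x; rewrite piT; exact: hT.
move=> f; have [M M0 bM] := Cc_I_bounded f.
apply: (bop_exists (integral_linear f hT) M0) => x.
exact: integral_bound.
Qed.

Lemma lincomb_mul L L' x :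
  lincomb Pi L (lincomb Pi L' x) = lincomb Pi (cmul L L') x.
Proof.
rewrite /lincomb big_allpairs_dep /=; apply: eq_bigr => p _.
rewrite linear_sum scaler_sumr; apply: eq_bigr => q _.
by rewrite linearZ /= scalerA gis_mul.
Qed.

Lemma lincomb_adj L x y : '[lincomb Pi L x, y] = '[x, lincomb Pi (cstar L) y].
Proof.
rewrite /lincomb big_map linear_sumlz linear_sumr; apply: eq_bigr => p _ /=.
by rewrite linearZl_LR linearZr_LR /= conjCK (sr_star rPi).
Qed.

Variables (pi : Cc R E -> bop H).
Hypothesis (hpi : integrates pi).

Lemma integral_chi s : pi (chi R s) = Pi s.
Proof.
apply: bop_ext => x; apply: (@eq_small _ _ _ _ `|x|) => // e e0.
have := @hpi (chi R s) x e [:: (1, s)] e0.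
rewrite /lincomb big_seq1 scale1r; apply=> r u D _ _.
rewrite big1 ?ltW// => g _.
by rewrite CcB combE big_seq1 mul1r subrr normr0.
Qed.

Lemma integral_add (c : C) f h x : pi (c *: f + h) x = c *: pi f x + pi h x.
Proof.
apply: (@eq_small _ _ _ _ ((`|c| + 1) * `|x| * 2%:R)) => [|e e0].
  by rewrite !mulr_ge0// addr_ge0.
have [L bL] := Cc_dense f e0; have [L' bL'] := Cc_dense h e0.
pose L2 := [seq (c * p.1, p.2) | p <- L] ++ L'.
have e20 : 0 < `|c| * e + e by rewrite ltr_wpDl// mulr_ge0// ltW.
have bL2 : I_bounded (`|c| * e + e) (c *: f + h - comb L2 : Cc R E).
  apply: eq_I_bounded (I_boundedD (I_boundedZ c bL) bL') => g.
  by rewrite !CcB CcD CcZ combD combZ mulrBr opprD addrACA.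
rewrite (subr_pairwise _ _ _ (c *: lincomb Pi L x) (lincomb Pi L' x)).
rewrite -scalerBr -lincomb_scale -lincomb_cat -/L2.
apply: le_trans (ler_normB _ _) _.
have -> : e * ((`|c| + 1) * `|x| * 2%:R) =
    (`|c| * e + e) * `|x| + (`|c| * (e * `|x|) + e * `|x|).
  rewrite mulr_natr mulr2n mulrDr mulrA [e * _]mulrC mulrDl mul1r mulrDl.
  by rewrite mulrA.
apply: lerD; first exact: hpi.
apply: le_trans (ler_normD _ _) _; apply: lerD; last exact: hpi.
by rewrite normrZ; apply: ler_wpM2l => //; exact: hpi.
Qed.

Lemma integral_mul f h k : (k : _ -> _) = convol f h ->
  forall x, pi k x = pi f (pi h x).
Proof.
move=> kE x.
have [M M0 bM] := Cc_I_bounded f; have [M' M'0 bM'] := Cc_I_bounded h.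
pose K := (M' + (M + 1)) * `|x| + (`|pi h x| + (M + 1) * `|x|).
have K0 : 0 <= K by rewrite !(addr_ge0, mulr_ge0).
apply: (@eq_small _ _ _ _ K) => // e e0.
have e1 : 0 < 1 + e by rewrite addr_gt0.
(* d <= 1 makes the quadratic error term linear in d *)
pose d := e / (1 + e).
have d0 : 0 < d by rewrite divr_gt0.
have d1 : d <= 1 by rewrite ler_pdivrMr// mul1r lerDr.
have de : d <= e by rewrite ler_pdivrMr// mulrDr mulr1 lerDl mulr_ge0// ltW.
apply: (@le_trans _ _ (d * K)); last exact: ler_wpM2r.
have [L bL] := Cc_dense f d0; have [L' bL'] := Cc_dense h d0.
have bL1 : I_bounded (M + 1) (comb L).
  exact: I_bounded_approx bM (I_bounded_le d1 bL).
have [ts [nts _]] := Cc_step f; have [ts' nts'] := comb_narrow L.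
have bk : I_bounded (d * M' + (M + 1) * d) (k - comb (cmul L L') : Cc R E).
  apply: eq_I_bounded (I_bounded_convolB nts nts' bM' bL1 bL bL') => g.
  by rewrite CcB kE convol_comb.
have d20 : 0 < d * M' + (M + 1) * d.
  apply: ltr_wpDl; first by rewrite mulr_ge0// ltW.
  by rewrite mulr_gt0// ltr_wpDl.
have h1 := hpi x d20 bk.
have h2 := hpi (pi h x) d0 bL.
have h3 : `|lincomb Pi L (pi h x) - lincomb Pi L (lincomb Pi L' x)| <=
    (M + 1) * (d * `|x|).
  have -> : lincomb Pi L (pi h x) - lincomb Pi L (lincomb Pi L' x) =
      lincomb Pi L (pi h x - lincomb Pi L' x).
    by rewrite /lincomb -sumrB; apply: eq_bigr => p _; rewrite linearB scalerBr.
  apply: le_trans (lincomb_bound rPi hE _ _ bL1) _; first by rewrite addr_ge0.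
  by apply: ler_wpM2l; [rewrite addr_ge0|exact: hpi].
rewrite -lincomb_mul in h1; rewrite distrC in h2; rewrite distrC in h3.
apply: le_trans (ler_distD (lincomb Pi L (lincomb Pi L' x)) _ _) _.
rewrite /K mulrDr; apply: lerD.
  by apply: le_trans h1 _; rewrite [in leRHS]mulrA mulrDr [_ * d]mulrC.
apply: le_trans (ler_distD (lincomb Pi L (pi h x)) _ _) _.
rewrite addrC mulrDr; apply: lerD; first by [].
by apply: le_trans h3 _; rewrite mulrCA.
Qed.

Lemma integral_star f : is_adjoint (pi f) (pi (Cc_star f)).
Proof.
move=> x y; apply/eqP; rewrite -subr_eq0 -normr_le0.
apply: (@le_small _ _ _ (`|x| * `|y| * 2%:R)); first by rewrite !mulr_ge0.
move=> e e0; rewrite add0r; have [L bL] := Cc_dense f e0.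
have bL' : I_bounded e (Cc_star f - comb (cstar L) : Cc R E).
  apply: eq_I_bounded (I_bounded_ginv bL) => g.
  by rewrite !CcB comb_star rmorphB.
have -> : '[pi f x, y] - '[x, pi (Cc_star f) y] =
    '[pi f x - lincomb Pi L x, y] -
    '[x, pi (Cc_star f) y - lincomb Pi (cstar L) y].
  by rewrite linearBl linearBr /= lincomb_adj opprB addrA subrK.
apply: le_trans (ler_normB _ _) _; rewrite mulr_natr mulr2n mulrDr.
apply: lerD; apply: le_trans (hdot_le_norm _ _) _.
  by rewrite mulrA; apply: ler_wpM2r => //; exact: hpi.
by rewrite mulrCA; apply: ler_wpM2l => //; exact: hpi.
Qed.

Lemma integral_rep : is_groupoid_rep pi.
Proof.
split.
- exact: integral_add.
- exact: integral_mul.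
- exact: integral_star.
- move=> f eps eps0; exists eps => // h hf x.
  have -> : pi h x - pi f x = pi (h - f) x.
    by rewrite addrC -scaleN1r -integral_add scaleN1r addrC.
  apply: (integral_bound x hpi); first by rewrite lecR ltW.
  by apply/I_normP; exact: ltW.
- move=> A A0 oA; have [x [Ax [s xE]]] := sr_nondeg rPi A0 oA.
  exists x; split=> //; exists [seq (chi R p.1, p.2) | p <- s].
  by rewrite xE big_map; apply: eq_bigr => p _; rewrite integral_chi.
Qed.

End Integral.

Lemma groupoid_gis_bij (R : realType) (E : digraph) (H : hilbertType R) :
  no_sinks E ->
  set_bij (@groupoid_reps R H E) (@gis_reps R H E)
    (fun (pi : Cc R E -> bop H) (s : gis E) => pi (chi R s)).
Proof.
move=> hE; split.
- by move=> pi rpi; exact: groupoid_gis_rep.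
- move=> pi pi' /set_mem r /set_mem r' e; apply: groupoid_rep_eq => // s.
  exact: (congr1 (@^~ s) e).
- move=> Pi rPi; have [pi hpi] := integral_op rPi hE.
  exists pi; first exact: integral_rep hpi.
  by apply/funext => s; exact: integral_chi.
Qed.

Theorem theorem2 (R : realType) (E : digraph) (hE : no_sinks E)
    (H : hilbertType R) :
  set_bij (@gis_reps R H E) (@graph_reps R H E)
    (fun Pi : gis E -> bop H =>
       ((fun v => Pi (spp (vpath v) (vpath v))),
        (fun e => Pi (spp (epath e) (vpath (etgt e)))))) /\
  set_bij (@groupoid_reps R H E) (@gis_reps R H E)
    (fun (pi : Cc R E -> bop H) (s : gis E) => pi (chi R s)).
Proof. by split; [exact: gis_graph_bij | exact: groupoid_gis_bij]. Qed.
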